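(* For $i=1,2$, let $\mathbb{D}_{Q_i}\subset\mathbb{M}^{d_i}$ be a nc operator ball, and let $\mathfrak{X}\subset\mathbb{D}_{Q_1}$ be a relatively full nc subset. If $\mathbb{D}_{Q_2}$ is injective, then any nc map $S_0:\mathfrak{X}\to\overline{\mathbb{D}_{Q_2}}$ can be extended to a nc map $S:\mathbb{D}_{Q_1}\to\overline{\mathbb{D}_{Q_2}}$, i.e. $S|_{\mathfrak{X}}=S_0$. Furthermore, we have the following dichotomy: (1) If $S_0(\mathfrak{X})\subseteq\mathbb{D}_{Q_2}$, then $S(\mathbb{D}_{Q_1})\subseteq\mathbb{D}_{Q_2}$. (2) If $S_0(X)\in\partial\mathbb{D}_{Q_2}$ for some $X\in\mathfrak{X}$, then $S(\mathbb{D}_{Q_1})\subseteq\partial\mathbb{D}_{Q_2}$.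
   Context: $M_n^d$ is the set of $d$-tuples of complex $n\times n$ matrices; $\mathbb{M}^d=\sqcup_{n\ge1}M_n^d$; for $\Omega\subseteq\mathbb{M}^d$, $\Omega(n)=\Omega\cap M_n^d$. $\Omega$ is a nc set if it is closed under direct sums. A nc map $f:\Omega\to\mathbb{M}^l$ is a map that is graded ($X\in\Omega(n)\Rightarrow f(X)\in M_n^l$), satisfies $f(X\oplus Y)=f(X)\oplus f(Y)$, and $f(S^{-1}XS)=S^{-1}f(X)S$ whenever $S\in GL_n$ and $X,S^{-1}XS\in\Omega(n)$. NC operator ball: given Hilbert spaces $\mathcal{R},\mathcal{S}$ and linearly independent $Q_1,\dots,Q_d\in\mathcal{L}(\mathcal{R},\mathcal{S})$, put $Q(X)=\sum_jQ_j\otimes X_j$ for $X\in\mathbb{M}^d$ and $\mathbb{D}_Q=\{X\in\mathbb{M}^d:\|Q(X)\|<1\}$. Then $\overline{\mathbb{D}_Q}=\{X:\|Q(X)\|\le1\}$ is the level-wise closure and $\partial\mathbb{D}_Q=\overline{\mathbb{D}_Q}\setminus\mathbb{D}_Q=\{X:\|Q(X)\|=1\}$. $\mathbb{D}_Q$ is called injective if the operator space $\mathcal{E}=\operatorname{span}\{Q_1,\dots,Q_d\}$ is injective, i.e. for all operator spaces $\mathcal{F}\subset\mathcal{G}$ every completely contractive $u:\mathcal{F}\to\mathcal{E}$ has a completely contractive extension $\mathcal{G}\to\mathcal{E}$. A nc subset $\mathfrak{X}\subseteq\mathbb{D}_Q$ is relatively full in $\mathbb{D}_Q$ if: whenever $X\in\mathfrak{X}(n)$,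 $\widetilde{X}\in\mathbb{D}_Q(m)$ and there is an injective $n\times m$ matrix $I$ with $I\widetilde{X}_j=X_jI$ for all $j$, then $\widetilde{X}\in\mathfrak{X}$. *)

(* Defs.v *)
From HB Require Import structures.
From mathcomp Require Import all_boot all_order all_algebra.
From mathcomp Require Import complex.
From mathcomp Require Import all_classical all_reals all_analysis.
Import Order.TTheory GRing.Theory Num.Theory.
Import numFieldNormedType.Exports.

Set Implicit Arguments.
Unset Strict Implicit.
Unset Printing Implicit Defensive.

Local Open Scope classical_set_scope.
Local Open Scope ring_scope.

(* A complex Hilbert space: a complete normed space over [R[i]] whose norm
   comes from an inner product (linear in its first argument). *)
Structure hilbert (R : realType) := Hilbert {
  hsort :> completeNormedModType R[i];
  hdot : {dot hsort for Num.conj};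
  hdotE : forall x : hsort, `|x| ^+ 2 = hdot x x
}.

Section OperatorSpaces.
Variable R : realType.
Implicit Types H K : hilbert R.

(* The space L(H, K), as a set of functions; sums and scalar multiples of
   operators are those of the function space [H -> K]. *)
Definition bounded_op H K : set (H -> K) :=
  [set T | linear T /\ continuous T].

(* The norm of the Hilbert sum H^n; norms are [R[i]]-valued in the library,
   hence the real part. *)
Definition sum_norm H n (v : 'cV[H]_n) : R :=
  Num.sqrt (\sum_i complex.Re `|v i 0| ^+ 2).

Definition opmx_apply H K n (A : 'M[H -> K]_n) (v : 'cV[H]_n) : 'cV[K]_n :=
  \col_i \sum_k A i k (v k 0).

(* The norm of M_n(L(H, K)), identified with L(H^n, K^n). *)
Definition opmx_norm H K n (A : 'M[H -> K]_n) : \bar R :=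
  ereal_sup [set (sum_norm (opmx_apply A v))%:E
            | v in [set v : 'cV[H]_n | sum_norm v <= 1]].

Definition op_norm H K (T : H -> K) : \bar R :=
  opmx_norm (const_mx T : 'M[H -> K]_1).

(* Operator spaces are concrete: norm-closed subspaces of some L(H, K), with
   the matrix norms [opmx_norm]. *)
Definition operator_space H K (V : set (H -> K)) : Prop :=
  [/\ V `<=` @bounded_op H K,
      V 0,
      (forall (a : R[i]) S T, V S -> V T -> V (a *: S + T)) &
      (forall T : H -> K, bounded_op T ->
        (forall e : R, 0 < e ->
          exists2 S, V S & (op_norm (T \- S)%R < e%:E)%E) ->
        V T)].

(* [u] is a completely contractive linear map from V to W; its values outside
   V are irrelevant. *)
Definition completely_contractive H K H' K' (V : set (H -> K))
    (W : set (H' -> K')) (u : (H -> K) -> (H' -> K')) : Prop :=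
  [/\ (forall T, V T -> W (u T)),
      (forall (a : R[i]) S T, V S -> V T -> u (a *: S + T) = a *: u S + u T) &
      (forall n (A : 'M[H -> K]_n), (forall i j, V (A i j)) ->
        (opmx_norm (map_mx u A) <= opmx_norm A)%E)].

Definition injective_operator_space H K (E : set (H -> K)) : Prop :=
  forall (H' K' : hilbert R) (F G : set (H' -> K')),
    operator_space F -> operator_space G -> F `<=` G ->
    forall u, completely_contractive F E u ->
    exists v, completely_contractive G E v /\ (forall T, F T -> v T = u T).

Definition op_span H K d (Q : 'I_d -> H -> K) : set (H -> K) :=
  [set T | exists c : 'I_d -> R[i], T = \sum_j c j *: Q j].

Definition op_free H K d (Q : 'I_d -> H -> K) : Prop :=
  forall c : 'I_d -> R[i], \sum_j c j *: Q j = 0 -> forall j, c j = 0.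

End OperatorSpaces.

Section NC.
Variable R : realType.

(* M_n^d.  A subset of the nc universe is given by its levels Omega(n); as the
   levels of the universe are those with 0 < n, the balls below are empty at
   level 0. *)
Definition mtuple d n := {ffun 'I_d -> 'M[R[i]]_n}.

Definition mt_dsum d n m (X : mtuple d n) (Y : mtuple d m) : mtuple d (n + m) :=
  [ffun j => block_mx (X j) 0 0 (Y j)].

Definition mt_conj d n (S : 'M[R[i]]_n) (X : mtuple d n) : mtuple d n :=
  [ffun j => invmx S *m X j *m S].

Definition nc_subset d := forall n, set (mtuple d n).

Definition nc_set d (Omega : nc_subset d) : Prop :=
  forall n m (X : mtuple d n) (Y : mtuple d m),
    Omega n X -> Omega m Y -> Omega (n + m)%N (mt_dsum X Y).

(* [f] is an nc map from Omega to Delta; its values outside Omega are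
   irrelevant. *)
Definition nc_map d l (Omega : nc_subset d) (Delta : nc_subset l)
    (f : forall n, mtuple d n -> mtuple l n) : Prop :=
  [/\ (forall n X, Omega n X -> Delta n (f n X)),
      (forall n m (X : mtuple d n) (Y : mtuple d m), Omega n X -> Omega m Y ->
        f (n + m)%N (mt_dsum X Y) = mt_dsum (f n X) (f m Y)) &
      (forall n (X : mtuple d n) (S : 'M[R[i]]_n), S \in unitmx ->
        Omega n X -> Omega n (mt_conj S X) ->
        f n (mt_conj S X) = mt_conj S (f n X))].

(* Q(X) = sum_j Q_j (x) X_j, as an operator matrix. *)
Definition nc_lin (H K : hilbert R) d (Q : 'I_d -> H -> K) n (X : mtuple d n) :
    'M[H -> K]_n :=
  \matrix_(i, k) \sum_j X j i k *: Q j.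

Definition nc_ball (H K : hilbert R) d (Q : 'I_d -> H -> K) : nc_subset d :=
  fun n => [set X | (0 < n)%N /\ (opmx_norm (nc_lin Q X) < 1%:E)%E].
Arguments nc_ball [H K d] Q n _.

Definition nc_cball (H K : hilbert R) d (Q : 'I_d -> H -> K) : nc_subset d :=
  fun n => [set X | (0 < n)%N /\ (opmx_norm (nc_lin Q X) <= 1%:E)%E].
Arguments nc_cball [H K d] Q n _.

Definition nc_sphere (H K : hilbert R) d (Q : 'I_d -> H -> K) : nc_subset d :=
  fun n => nc_cball Q n `\` nc_ball Q n.
Arguments nc_sphere [H K d] Q n _.

Definition relatively_full d (X Omega : nc_subset d) : Prop :=
  forall n m (A : mtuple d n) (B : mtuple d m) (I : 'M[R[i]]_(n, m)),
    X n A -> Omega m B -> injective (fun v : 'cV[R[i]]_m => I *m v) ->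
    (forall j, I *m B j = A j *m I) -> X m B.

End NC.
Arguments nc_ball [R H K d] Q n _.
Arguments nc_cball [R H K d] Q n _.
Arguments nc_sphere [R H K d] Q n _.

(* Main.v *)
From HB Require Import structures.
Require Import Defs.
From mathcomp Require Import all_boot all_order all_algebra.
From mathcomp Require Import complex.
From mathcomp Require Import all_classical all_reals all_analysis.
From mathcomp Require Import ring lra.
Import Order.TTheory GRing.Theory Num.Theory.
Import numFieldNormedType.Exports.

(* Coefficient functionals p |-> <p(A) beta, alpha> on nc polynomials, for A in
   D_Q1 and vectors alpha in S2^m, beta in R2^m, form a vector space; assigning
   to such a functional the least (|alpha|^2 + |beta|^2) / 2 over all its
   representations is sublinear.  On the functionals coming from A in X, the map
   F0 induces the linear form <F0(A) beta, alpha>.  This form is dominated by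
   the sublinear bound: two representations of one functional, by Z in X and by
   A in D_Q1, share a common subquotient B, and relative fullness puts a triangular
   matrix similar to a restriction of Z, with corner B, into X.  Hahn-Banach and
   Riesz then give a contractive extension with values in L(R2, S2) (x) M_n,
   which is nc because the functionals behave well under direct sums and
   similarities.  Injectivity provides a completely contractive projection of
   L(R2, S2) onto the span of Q2, which brings the values back to the closed
   ball.  The dichotomy is a maximum principle, read off from the values of F on
   2 x 2 upper triangular block matrices. *)

Set Implicit Arguments.
Unset Strict Implicit.
Unset Printing Implicit Defensive.
Local Open Scope classical_set_scope.
Local Open Scope ring_scope.
Local Open Scope sesquilinear_scope.

(** * Matrices *)

Section FieldMatrices.
Variable F : fieldType.

(** The extension is encoded so that being nc is nearly automatic: entry (i, k) of the new value at
    A depends only on the function w |-> (A^w)_ik on words, and direct sums and similarities act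
    linearly on such functions. What remains is contractivity at all matrix sizes at once, which
    becomes one condition on a real functional [f]: its value on the moments of (A, al, be) is at
    most (|al|^2 + |be|^2) / 2. Unlike |al| |be|, this expression is additive under direct sums, so
    sums of functionals are bounded for free; choosing al as the image of be turns it back into a
    norm bound. The least bound is never formed: Hahn-Banach is run on the set of admissible pairs
    (functional, bound). Real scalars suffice because a complex scalar can be moved between the
    tensor factors. Infinitely many words and vectors reduce to finite matrices since C^(n+m) has
    finite dimension. *)

Lemma kernel_splitting p q (M : 'M[F]_(p, q)) :
  exists r (I : 'M[F]_(q, r)) (I' : 'M[F]_(r, q)) (N : 'M[F]_(q, p)),
    [/\ M *m I = 0, I' *m I = 1%:M & I *m I' + N *m M = 1%:M].
Proof.
(* As M N M = M, [P] is an idempotent onto ker M; its rank factorisation supplies [I] and [I']. *)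
pose N := pinvmx M; pose P := 1%:M - N *m M.
have MP : M *m P = 0.
  by rewrite mulmxBr mulmx1 mulmxA mulmxKpV ?submx_refl ?subrr.
have PP : P *m P = P by rewrite {1}/P mulmxBl mul1mx -mulmxA MP mulmx0 subr0.
have := mulmx_base P; have := col_base_full P; have := row_base_free P.
move: (row_base P) (col_base P) => B A Bfree Afull AB.
exists (\rank P), A, B, N; split.
- by apply: (row_free_inj Bfree); rewrite -mulmxA AB MP mul0mx.
- apply: (row_full_inj Afull); apply: (row_free_inj Bfree).
  by rewrite mulmx1 mulmxA AB -mulmxA AB PP.
- by rewrite AB subrK.
Qed.

(** Rows from [D] of maximal rank span [D], since one more row cannot raise the rank. This replaces
    infinitely many linear conditions by a single matrix. *)
Lemma row_sample N (D : 'rV[F]_N -> Prop) :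
  exists p (M : 'M[F]_(p, N)),
    (forall i, D (row i M)) /\ (forall u, D u -> (u <= M)%MS).
Proof.
pose P k := `[< exists p (M : 'M[F]_(p, N)), (forall i, D (row i M)) /\ \rank M = k >].
have P0 : exists k, P k.
  exists 0%N; apply/asboolP; exists 0%N, (0 : 'M[F]_(0, N)); split; first by case.
  by rewrite mxrank0.
have Pb k : P k -> (k <= N)%N.
  by move=> /asboolP[p [M [_ <-]]]; exact: rank_leq_col.
case: (ex_maxnP P0 Pb) => k /asboolP[p [M [DM rM]]] max.
exists p, M; split=> // u Du.
have D' i : D (row i (col_mx M u)).
  case: (split_ordP i) => j ->; rewrite ?rowKu ?rowKd //.
  by rewrite row_id.
have /max : P (\rank (col_mx M u)) by apply/asboolP; exists (p + 1)%N, (col_mx M u).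
rewrite -rM => le.
have sub : (M <= col_mx M u)%MS by rewrite -addsmxE addsmxSl.
have : (col_mx M u <= M)%MS by rewrite -(geq_leqif (mxrank_leqif_sup sub)).
by rewrite -addsmxE addsmx_sub => /andP[].
Qed.

End FieldMatrices.

Section ClosedMatrices.
Variable C : numClosedFieldType.

(** Gram-Schmidt on the column space of [I], passed through transposes because [schmidt]
    orthonormalises rows. *)
Lemma orthonormal_range q r (I : 'M[C]_(q, r)) :
  exists b (J : 'M[C]_(q, b)) (G : 'M[C]_(r, b)) (H : 'M[C]_(b, r)),
    [/\ J ^t* *m J = 1%:M, J = I *m G & I = J *m H].
Proof.
pose W := row_base I^T; pose U := schmidt W.
have UU : U *m U ^t* = 1%:M by apply/unitarymxP/schmidt_unitarymx/rank_leq_col.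
have eUI : (U :=: I^T)%MS.
  by apply: eqmx_trans (eqmx_schmidt_free (row_base_free _)) (eq_row_base _).
have /submxP[G eG] : (U <= I^T)%MS by rewrite eUI.
have /submxP[H eH] : (I^T <= U)%MS by rewrite eUI.
exists (\rank I^T), (U^T), (G^T), (H^T); split.
- apply: (can_inj trmxK); rewrite trmx_mul trmx1 -[RHS]UU trmxK; congr (_ *m _).
  by apply/matrixP=> i j; rewrite !mxE.
- by rewrite {1}eG trmx_mul trmxK.
- by rewrite -trmx_mul -eH trmxK.
Qed.

Lemma adjmxM m n p (A : 'M[C]_(m, n)) (B : 'M[C]_(n, p)) :
  (A *m B) ^t* = B ^t* *m A ^t*.
Proof. by rewrite trmx_mul map_mxM. Qed.

(* [L] spans ker M1 isometrically; [J] and [Sg] are two lifts of one basis of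
   ran M1 /\ ran M2, the lift [J] through M2 being isometric with range
   orthogonal to ker M2. *)
Lemma common_range p n m (M1 : 'M[C]_(p, n)) (M2 : 'M[C]_(p, m)) :
  exists k (L : 'M[C]_(n, k)) (N : 'M[C]_(n, p))
         b (J : 'M[C]_(m, b)) (Sg : 'M[C]_(n, b)) (Om : 'M[C]_(b, p))
         (Th : 'M[C]_(p, p)),
  [/\ [/\ L ^t* *m L = 1%:M, M1 *m L = 0 & 1%:M - L *m L ^t* = N *m M1],
      J ^t* *m J = 1%:M, M1 *m Sg = M2 *m J, J ^t* = Om *m M2 &
      Th *m M1 = 0 /\ M2 - M2 *m J *m J ^t* = Th *m M2].
Proof.
have [r0 [I0 [I0' [N0 [MI0 II0 IN0]]]]] := kernel_splitting M1.
have [k [L [G0 [H0 [LL LG LH]]]]] := orthonormal_range I0.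
(* The columns of [J0] form an orthonormal basis of the orthogonal complement of ker M2. *)
have [b0 [J0 [G1 [H1 [JJ0 JG0 JH0]]]]] := orthonormal_range (M2 ^t*).
have M2J0 : M2 *m J0 *m J0 ^t* = M2.
  rewrite -{1}(trmxCK M2) JH0 adjmxM -(mulmxA _ _ J0) JJ0 mulmx1 -adjmxM -JH0.
  by rewrite trmxCK.
(* Kernel vectors (x, z) of this row are the solutions of M1 x = M2 J0 z, so they parametrise ran M1
   /\ ran M2; [J1] orthonormalises their z-parts. *)
have [r2 [I2 [I2' [N2 [MI2 II2 IN2]]]]] := kernel_splitting (row_mx M1 (- (M2 *m J0))).
pose Ix := usubmx I2; pose Iz := dsubmx I2.
have MI : M1 *m Ix = M2 *m J0 *m Iz.
  move: MI2; rewrite -[I2]vsubmxK mul_row_col mulNmx => /eqP.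
  by rewrite subr_eq0 => /eqP.
have [b [J1 [G [H [JJ1 JG1 JH1]]]]] := orthonormal_range Iz.
pose J := J0 *m J1.
have JJ : J ^t* *m J = 1%:M.
  by rewrite adjmxM -mulmxA (mulmxA _ J0) JJ0 mul1mx.
have key q (x : 'M[C]_(n, q)) (y : 'M[C]_(m, q)) : M1 *m x = M2 *m y ->
    M2 *m y = M2 *m J *m J ^t* *m y.
  move=> xy; pose z := col_mx x (J0 ^t* *m y).
  have Mz : row_mx M1 (- (M2 *m J0)) *m z = 0.
    by rewrite mul_row_col mulNmx mulmxA M2J0 xy subrr.
  have zE : z = I2 *m (I2' *m z).
    by rewrite mulmxA -[LHS]mul1mx -IN2 mulmxDl -(mulmxA N2) Mz mulmx0 addr0.
  have zI : J0 ^t* *m y = J1 *m (H *m (I2' *m z)).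
    by rewrite mulmxA -JH1 /Iz mul_dsub_mx -zE col_mxKd.
  rewrite -!mulmxA adjmxM -(mulmxA _ _ y) zI (mulmxA (J1 ^t*)) JJ1 mul1mx.
  by rewrite -zI !mulmxA M2J0.
(* By [key], the row [D] below kills the kernel of [M1, -M2], hence factors through that row; the
   two halves of the factorisation are the two equations for [Th]. *)
have [r3 [I3 [I3' [N3 [MI3 II3 IN3]]]]] := kernel_splitting (row_mx M1 (- M2)).
pose D := row_mx (0 : 'M[C]_(p, n)) (M2 - M2 *m J *m J ^t*).
have DI : D *m I3 = 0.
  move: MI3; rewrite -[I3]vsubmxK !mul_row_col mulNmx mul0mx add0r => /eqP.
  rewrite subr_eq0 => /eqP /key e.
  by rewrite mulmxBl -e subrr.
have DE : D = (D *m N3) *m row_mx M1 (- M2).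
  rewrite -[LHS]mulmx1 -IN3 mulmxDr mulmxA DI mul0mx add0r.
  by rewrite !mulmxA.
exists k, L, ((1%:M - L *m L ^t*) *m N0), b, J, (Ix *m G), (J1 ^t* *m G1 ^t*), (- (D *m N3)).
split.
- split=> //; first by rewrite LG mulmxA MI0 mul0mx.
  rewrite -[LHS]mulmx1 -{2}IN0 mulmxDr (mulmxA _ I0) [X in X *m I0']mulmxBl mul1mx.
  rewrite {2}LH -(mulmxA L (L ^t*)) (mulmxA (L ^t*)) LL mul1mx -LH subrr mul0mx add0r.
  by rewrite mulmxA.
- exact: JJ.
- by rewrite mulmxA MI /J mulmxA -mulmxA -JG1.
- rewrite adjmxM -mulmxA; congr (_ *m _).
  by rewrite JG0 adjmxM trmxCK.
- move: DE; rewrite mul_mx_row => /eq_row_mx[e1 e2]; split.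
    by rewrite mulNmx -e1 oppr0.
  by rewrite e2 mulmxN mulNmx.
Qed.

End ClosedMatrices.

(** * Hilbert spaces *)

Section RealInnerProduct.
Variable R : realType.
Local Notation C := R[i].
Implicit Types H K : hilbert R.

(** The Hilbert space is treated as a real one, because Hahn-Banach and Riesz are used over the
    reals; [rdotZl] keeps track of complex scalars. *)
Definition rdot H (x y : H) : R := complex.Re (hdot H x y).
Local Notation nrm2 x := (rdot x x).

Lemma ReD (x y : C) : complex.Re (x + y) = complex.Re x + complex.Re y.
Proof. by case: x; case: y. Qed.

Lemma ReZ (a : R) (x : C) : complex.Re (a%:C%C * x) = a * complex.Re x.
Proof. by case: x => u v /=; rewrite mul0r subr0. Qed.

Lemma conj_real (a : R) : (a%:C%C)^* = a%:C%C :> C.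
Proof. by rewrite conj_Creal //; apply/complex_realP; exists a. Qed.

Lemma Re_conj (x : C) : complex.Re (x^*) = complex.Re x.
Proof. by case: x. Qed.

Lemma rdotC H (x y : H) : rdot x y = rdot y x.
Proof. by rewrite /rdot hermC expr0 mul1r Re_conj. Qed.

Lemma rdotDl H (x y z : H) : rdot (x + y) z = rdot x z + rdot y z.
Proof. by rewrite /rdot linearDl ReD. Qed.

Lemma rdotDr H (x y z : H) : rdot z (x + y) = rdot z x + rdot z y.
Proof. by rewrite rdotC rdotDl !(rdotC z). Qed.

Lemma rdot0l H (x : H) : rdot 0 x = 0.
Proof. by rewrite /rdot linear0l. Qed.

Lemma rdot0r H (x : H) : rdot x 0 = 0.
Proof. by rewrite rdotC rdot0l. Qed.

Lemma rdotZl H (a : C) (x y : H) : rdot (a *: x) y = rdot x (a^* *: y).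
Proof. by rewrite /rdot linearZl_LR linearZr_LR /= conjCK. Qed.

Lemma rdotRl H (a : R) (x y : H) : rdot (a%:C%C *: x) y = a * rdot x y.
Proof. by rewrite /rdot linearZl_LR ReZ. Qed.

Lemma rdotRr H (a : R) (x y : H) : rdot x (a%:C%C *: y) = a * rdot x y.
Proof. by rewrite rdotC rdotRl rdotC. Qed.

Lemma rdotNl H (x y : H) : rdot (- x) y = - rdot x y.
Proof. by apply/eqP; rewrite -addr_eq0 -rdotDl addNr rdot0l. Qed.

Lemma rdotNr H (x y : H) : rdot x (- y) = - rdot x y.
Proof. by rewrite rdotC rdotNl rdotC. Qed.

Lemma rdot_suml H I (r : seq I) (P : pred I) (F : I -> H) y :
  rdot (\sum_(i <- r | P i) F i) y = \sum_(i <- r | P i) rdot (F i) y.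
Proof.
by apply: (big_morph (fun x => rdot x y)) => [u v|]; rewrite ?rdotDl ?rdot0l.
Qed.

Lemma rdot_sumr H I (r : seq I) (P : pred I) (F : I -> H) y :
  rdot y (\sum_(i <- r | P i) F i) = \sum_(i <- r | P i) rdot y (F i).
Proof. by rewrite rdotC rdot_suml; apply: eq_bigr => i _; rewrite rdotC. Qed.

Lemma hdot_nrm2 H (x : H) : hdot H x x = (nrm2 x)%:C%C.
Proof. by rewrite /rdot RRe_real // ger0_real // dnorm_ge0. Qed.

Lemma nrm2_ge0 H (x : H) : 0 <= nrm2 x.
Proof. by rewrite -lecR -hdot_nrm2 dnorm_ge0. Qed.

Lemma nrm2_eq0 H (x : H) : nrm2 x = 0 -> x = 0.
Proof.
by move=> x0; apply/eqP; rewrite -(dnorm_eq0 (hdot H)) hdot_nrm2 x0.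
Qed.

Lemma rdot_ext H (x y : H) : (forall z, rdot x z = rdot y z) -> x = y.
Proof.
move=> xy; apply/subr0_eq/nrm2_eq0.
by rewrite rdotDl rdotNl xy subrr.
Qed.

Lemma nrm2E H (x : H) : (complex.Re `|x|) ^+ 2 = nrm2 x.
Proof.
have nr : `|x| = (complex.Re `|x|)%:C%C by rewrite RRe_real // ger0_real.
apply: complexI; rewrite -hdot_nrm2 -hdotE [in RHS]nr.
by rewrite rmorphXn.
Qed.

Lemma hilbert_normE H (x : H) : `|x| = (Num.sqrt (nrm2 x))%:C%C.
Proof.
have nr : `|x| = (complex.Re `|x|)%:C%C by rewrite RRe_real // ger0_real.
rewrite -nrm2E sqrtr_sqr ger0_norm // -lecR -nr.
exact: normr_ge0.
Qed.

Definition sqmod (z : C) : R := complex.Re z ^+ 2 + complex.Im z ^+ 2.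

Lemma sqmod_ge0 z : 0 <= sqmod z.
Proof. by rewrite addr_ge0 ?sqr_ge0. Qed.

Lemma nrm2Z H (a : C) (x : H) : nrm2 (a *: x) = sqmod a * nrm2 x.
Proof.
by apply: complexI; rewrite rmorphM -hdot_nrm2 dnormZ -add_Re2_Im2 hdot_nrm2.
Qed.

Lemma rdot_le H (x y : H) : 2 * rdot x y <= nrm2 x + nrm2 y.
Proof.
have := nrm2_ge0 (x - y).
rewrite !(rdotDl, rdotDr, rdotNl, rdotNr) (rdotC y x).
lra.
Qed.

Lemma rdotD_le H (x y : H) : nrm2 (x + y) <= 2 * nrm2 x + 2 * nrm2 y.
Proof.
have := rdot_le x y; rewrite !(rdotDl, rdotDr) (rdotC y x).
lra.
Qed.

(** * Columns of vectors and scalar matrices acting on them *)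

Definition sdot H n (v w : 'cV[H]_n) : R := \sum_i rdot (v i 0) (w i 0).

Lemma sum_normE H n (v : 'cV[H]_n) : sum_norm v = Num.sqrt (sdot v v).
Proof. by congr Num.sqrt; apply: eq_bigr => i _; rewrite nrm2E. Qed.

Lemma sdotC H n (v w : 'cV[H]_n) : sdot v w = sdot w v.
Proof. by apply: eq_bigr => i _; rewrite rdotC. Qed.

Lemma sdotDl H n (u v w : 'cV[H]_n) : sdot (u + v) w = sdot u w + sdot v w.
Proof. by rewrite /sdot -big_split; apply: eq_bigr => i _; rewrite mxE rdotDl. Qed.

Lemma sdotDr H n (u v w : 'cV[H]_n) : sdot w (u + v) = sdot w u + sdot w v.
Proof. by rewrite sdotC sdotDl !(sdotC w). Qed.

Lemma sdot0l H n (w : 'cV[H]_n) : sdot 0 w = 0.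
Proof. by rewrite /sdot big1 // => i _; rewrite mxE rdot0l. Qed.

Lemma sdot0r H n (w : 'cV[H]_n) : sdot w 0 = 0.
Proof. by rewrite sdotC sdot0l. Qed.

Lemma sdotNl H n (u w : 'cV[H]_n) : sdot (- u) w = - sdot u w.
Proof. by apply/eqP; rewrite -addr_eq0 -sdotDl addNr sdot0l. Qed.

Lemma sdotNr H n (u w : 'cV[H]_n) : sdot w (- u) = - sdot w u.
Proof. by rewrite sdotC sdotNl sdotC. Qed.

Lemma snrm2_ge0 H n (v : 'cV[H]_n) : 0 <= sdot v v.
Proof. by apply: sumr_ge0 => i _; apply: nrm2_ge0. Qed.

Lemma snrm2_eq0 H n (v : 'cV[H]_n) : sdot v v = 0 -> v = 0.
Proof.
move=> /eqP; rewrite psumr_eq0 => [/allP v0|i _]; last exact: nrm2_ge0.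
apply/colP => i; rewrite mxE; apply: nrm2_eq0.
by apply/eqP/v0; rewrite mem_index_enum.
Qed.

Lemma sdot_le H n (v w : 'cV[H]_n) : 2 * sdot v w <= sdot v v + sdot w w.
Proof.
by rewrite mulr_sumr -big_split; apply: ler_sum => i _; apply: rdot_le.
Qed.

(** The cross term is bounded by expanding |e v - w|^2 >= 0. A small [e] keeps the coefficient of
    |v|^2 near 1, which the perturbation arguments below rely on. *)
Lemma sdotD_le H n (v w : 'cV[H]_n) (e : R) : 0 < e ->
  sdot (v + w) (v + w) <= (1 + e) * sdot v v + (1 + e^-1) * sdot w w.
Proof.
move=> e0.
rewrite /sdot !mulr_sumr -big_split; apply: ler_sum => i _; rewrite mxE /=.
move: (v i 0) (w i 0) => x y.
have := nrm2_ge0 (e%:C%C *: x - y).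
rewrite !(rdotDl, rdotDr, rdotNl, rdotNr, rdotRl, rdotRr) (rdotC y x) => h.
have ei : 0 <= e^-1 by rewrite invr_ge0 ltW.
have := mulr_ge0 ei h.
have -> : e^-1 * (e * (e * nrm2 x - rdot x y) - (e * rdot x y - nrm2 y))
    = e * nrm2 x - 2 * rdot x y + e^-1 * nrm2 y.
  by field; rewrite gt_eqF.
lra.
Qed.

Lemma sdot_col H n m (v v' : 'cV[H]_n) (w w' : 'cV[H]_m) :
  sdot (col_mx v w) (col_mx v' w') = sdot v v' + sdot w w'.
Proof.
rewrite /sdot big_split_ord; congr (_ + _); apply: eq_bigr => i _.
  by rewrite !col_mxEu.
by rewrite !col_mxEd.
Qed.

Definition smul H n m (S : 'M[C]_(n, m)) (v : 'cV[H]_m) : 'cV[H]_n :=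
  \col_i \sum_k S i k *: v k 0.

Lemma smulA H n m p (S : 'M[C]_(n, m)) (T : 'M[C]_(m, p)) (v : 'cV[H]_p) :
  smul (S *m T) v = smul S (smul T v).
Proof.
apply/colP => i; rewrite !mxE.
under eq_bigr do rewrite mxE scaler_suml.
rewrite exchange_big; apply: eq_bigr => k _.
by rewrite mxE scaler_sumr; apply: eq_bigr => j _; rewrite scalerA.
Qed.

Lemma smul1 H n (v : 'cV[H]_n) : smul 1%:M v = v.
Proof.
apply/colP => i; rewrite mxE (bigD1 i) //= mxE eqxx scale1r big1 ?addr0 // => k ki.
by rewrite mxE eq_sym (negPf ki) scale0r.
Qed.

Lemma smulDl H n m (S T : 'M[C]_(n, m)) (v : 'cV[H]_m) :
  smul (S + T) v = smul S v + smul T v.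
Proof.
apply/colP => i; rewrite !mxE -big_split; apply: eq_bigr => k _.
by rewrite mxE scalerDl.
Qed.

Lemma smulDr H n m (S : 'M[C]_(n, m)) (v w : 'cV[H]_m) :
  smul S (v + w) = smul S v + smul S w.
Proof.
apply/colP => i; rewrite !mxE -big_split; apply: eq_bigr => k _.
by rewrite mxE scalerDr.
Qed.

Lemma smul0l H n m (v : 'cV[H]_m) : smul (0 : 'M[C]_(n, m)) v = 0.
Proof. by apply/colP => i; rewrite !mxE big1 // => k _; rewrite mxE scale0r. Qed.

Lemma smul0r H n m (S : 'M[C]_(n, m)) : smul S (0 : 'cV[H]_m) = 0.
Proof. by apply/colP => i; rewrite !mxE big1 // => k _; rewrite mxE scaler0. Qed.

Lemma smulNl H n m (S : 'M[C]_(n, m)) (v : 'cV[H]_m) : smul (- S) v = - smul S v.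
Proof. by apply/eqP; rewrite -addr_eq0 -smulDl addNr smul0l. Qed.

Lemma smulNr H n m (S : 'M[C]_(n, m)) (v : 'cV[H]_m) : smul S (- v) = - smul S v.
Proof. by apply/eqP; rewrite -addr_eq0 -smulDr addNr smul0r. Qed.

Lemma smul_scalarE H n (a : C) (v : 'cV[H]_n) i : smul a%:M v i 0 = a *: v i 0.
Proof.
rewrite mxE (bigD1 i) //= mxE eqxx mulr1n big1 ?addr0 // => k ki.
by rewrite mxE eq_sym (negPf ki) mulr0n scale0r.
Qed.

Lemma smul_row_col H n m p (S : 'M[C]_(n, m)) (T : 'M[C]_(n, p))
    (v : 'cV[H]_m) (w : 'cV[H]_p) :
  smul (row_mx S T) (col_mx v w) = smul S v + smul T w.
Proof.
apply/colP => i; rewrite !mxE big_split_ord; congr (_ + _); apply: eq_bigr => k _.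
  by rewrite row_mxEl col_mxEu.
by rewrite row_mxEr col_mxEd.
Qed.

Lemma sdot_smul H n m (S : 'M[C]_(n, m)) (v : 'cV[H]_m) (w : 'cV[H]_n) :
  sdot (smul S v) w = sdot v (smul (S ^t*) w).
Proof.
rewrite /sdot.
under eq_bigr do rewrite mxE rdot_suml.
rewrite exchange_big; apply: eq_bigr => k _.
rewrite mxE rdot_sumr; apply: eq_bigr => i _.
by rewrite !mxE rdotZl.
Qed.

Lemma sdot_smulr H n m (S : 'M[C]_(n, m)) (v : 'cV[H]_m) (w : 'cV[H]_n) :
  sdot w (smul S v) = sdot (smul (S ^t*) w) v.
Proof. by rewrite sdotC sdot_smul sdotC. Qed.

Lemma sdotR H n (a : R) (v w : 'cV[H]_n) :
  sdot (smul (a%:C%C)%:M v) w = a * sdot v w.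
Proof.
rewrite /sdot mulr_sumr; apply: eq_bigr => i _.
by rewrite smul_scalarE rdotRl.
Qed.

Lemma smul_isometry H n m (J : 'M[C]_(n, m)) (v : 'cV[H]_m) :
  J ^t* *m J = 1%:M -> sdot (smul J v) (smul J v) = sdot v v.
Proof. by move=> JJ; rewrite sdot_smul -smulA JJ smul1. Qed.

Lemma smul_coisometry H n m (J : 'M[C]_(n, m)) (v : 'cV[H]_n) :
  J ^t* *m J = 1%:M -> sdot (smul (J ^t*) v) (smul (J ^t*) v) <= sdot v v.
Proof.
move=> JJ; set w := smul _ v.
have := snrm2_ge0 (v - smul J w).
rewrite !(sdotDl, sdotDr, sdotNl, sdotNr) smul_isometry // sdot_smul -/w.
rewrite sdot_smulr -/w; lra.
Qed.

Lemma linear_map0 H K (T : H -> K) : linear T -> T 0 = 0.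
Proof.
move=> lT; have := lT (-1) 0 0; rewrite scaler0 addr0 scaleN1r addNr.
by [].
Qed.

Lemma linear_mapD H K (T : H -> K) x y : linear T -> T (x + y) = T x + T y.
Proof. by move=> lT; have := lT 1 x y; rewrite !scale1r. Qed.

Lemma linear_mapZ H K (T : H -> K) a x : linear T -> T (a *: x) = a *: T x.
Proof. by move=> lT; have := lT a x 0; rewrite addr0 linear_map0 // addr0. Qed.

Lemma linear_map_sum H K (T : H -> K) I (r : seq I) (P : pred I) (F : I -> H) :
  linear T -> T (\sum_(i <- r | P i) F i) = \sum_(i <- r | P i) T (F i).
Proof.
move=> lT; apply: (big_morph T) => [x y|]; [exact: linear_mapD|exact: linear_map0].
Qed.

Lemma bounded_opP H K (T : H -> K) :
  bounded_op T <->
  linear T /\ exists2 c : R, 0 <= c & forall x, nrm2 (T x) <= c * nrm2 x.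
Proof.
split=> -[lT cT]; split=> //;
  pose t : {linear H -> K} := HB.pack T (GRing.isLinear.Build _ _ _ _ T lT).
  have /linear_boundedP/pinfty_ex_gt0[r r0 rT] : bounded_near t (nbhs 0).
    exact/linear_bounded_continuous.
  have rE : r = (complex.Re r)%:C%C by rewrite RRe_real // gtr0_real.
  exists (complex.Re r ^+ 2); first exact: sqr_ge0.
  move=> x; rewrite -lecR rmorphM rmorphXn /= -!hdot_nrm2 -!hdotE -rE -exprMn.
  by rewrite lerXn2r ?nnegrE ?rT // mulr_ge0 // ltW.
case: cT => c c0 cT.
apply: (@bounded_linear_continuous _ _ _ t); apply/linear_boundedP.
exists ((Num.sqrt c)%:C%C); split; first by apply: ger0_real; rewrite lecR sqrtr_ge0.
move=> r cr x.
have r0 : 0 <= r by apply: le_trans (ltW cr); rewrite lecR sqrtr_ge0.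
apply: (@le_trans _ _ ((Num.sqrt c)%:C%C * `|x|)); last by rewrite ler_wpM2r // ltW.
by rewrite !hilbert_normE -rmorphM lecR /= -sqrtrM // ler_wsqrtr.
Qed.

End RealInnerProduct.

(** * Operator matrices and nc balls *)

Section OperatorMatrices.
Variable R : realType.
Local Notation C := R[i].
Implicit Types H K : hilbert R.
Local Notation nrm2 x := (rdot x x).
Local Notation snrm2 x := (sdot x x).

Lemma opmx_apply_scalar H K n (A : 'M[H -> K]_n) (a : C) (v : 'cV[H]_n) :
  (forall i j, linear (A i j)) ->
  opmx_apply A (smul a%:M v) = smul a%:M (opmx_apply A v).
Proof.
move=> lA; apply/colP => i; rewrite mxE smul_scalarE mxE scaler_sumr.
by apply: eq_bigr => k _; rewrite smul_scalarE linear_mapZ.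
Qed.

Lemma snrm2R H n (a : R) (v : 'cV[H]_n) :
  snrm2 (smul (a%:C%C)%:M v) = a ^+ 2 * snrm2 v.
Proof. by rewrite sdotR sdotC sdotR mulrA. Qed.

Lemma opmx_norm_leP H K n (A : 'M[H -> K]_n) (c : R) :
  (forall i j, linear (A i j)) -> 0 <= c ->
  (opmx_norm A <= (Num.sqrt c)%:E)%E <->
  (forall v, snrm2 (opmx_apply A v) <= c * snrm2 v).
Proof.
move=> lA c0; split=> [Ac v|Ac].
  have [v0|v0] := eqVneq (snrm2 v) 0.
    rewrite (snrm2_eq0 v0) sdot0r mulr0.
    have -> : (0 : 'cV[H]_n) = smul (0%:C%C)%:M 0 by rewrite smul0r.
    by rewrite opmx_apply_scalar // snrm2R expr0n mul0r.
  have vp : 0 < snrm2 v by rewrite lt_def v0 snrm2_ge0.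
  pose a := (Num.sqrt (snrm2 v))^-1.
  have a2 : a ^+ 2 = (snrm2 v)^-1 by rewrite exprVn sqr_sqrtr // snrm2_ge0.
  have : ((sum_norm (opmx_apply A (smul (a%:C%C)%:M v)))%:E <= (Num.sqrt c)%:E)%E.
    apply: le_trans Ac; apply: ereal_sup_ubound.
    exists (smul (a%:C%C)%:M v) => //=.
    by rewrite sum_normE snrm2R a2 mulVf // sqrtr1.
  rewrite lee_fin sum_normE ler_sqrt // opmx_apply_scalar // snrm2R a2.
  by rewrite mulrC ler_pdivrMr.
apply: ge_ereal_sup => _ [v /= v1 <-]; rewrite lee_fin sum_normE.
rewrite ler_wsqrtr //; apply: le_trans (Ac v) _.
rewrite -[leRHS]mulr1 ler_wpM2l //.
move: v1; rewrite sum_normE -[1 in X in X -> _]sqrtr1 ler_sqrt //.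
Qed.

(** Families of rectangular matrices replace [mtuple], so that the blocks of a tuple can be treated
    separately. *)
Definition qact H K d (Q : 'I_d -> H -> K) n m (X : 'I_d -> 'M[C]_(n, m))
    (v : 'cV[H]_m) : 'cV[K]_n :=
  \col_i \sum_k \sum_j X j i k *: Q j (v k 0).

(** Here [c] bounds the square of the norm; strict membership in the ball becomes a bound with some
    c < 1. *)
Definition qbound H K d (Q : 'I_d -> H -> K) n m (X : 'I_d -> 'M[C]_(n, m)) (c : R) :=
  forall v, snrm2 (qact Q X v) <= c * snrm2 v.

Section Qact.
Variables (H K : hilbert R) (d : nat) (Q : 'I_d -> H -> K).

Lemma opmx_apply_nc_lin n (X : mtuple R d n) v : opmx_apply (nc_lin Q X) v = qact Q X v.
Proof.
apply/colP => i; rewrite !mxE; apply: eq_bigr => k _.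
by rewrite mxE fct_sumE.
Qed.

Lemma eq_qact n m (X Y : 'I_d -> 'M[C]_(n, m)) v :
  (forall j, X j = Y j) -> qact Q X v = qact Q Y v.
Proof.
move=> XY; apply/colP => i; rewrite !mxE; apply: eq_bigr => k _.
by apply: eq_bigr => j _; rewrite XY.
Qed.

Lemma eq_qbound n m (X Y : 'I_d -> 'M[C]_(n, m)) c :
  (forall j, X j = Y j) -> qbound Q X c -> qbound Q Y c.
Proof. by move=> XY h v; rewrite -(eq_qact v XY). Qed.

Lemma qactE n m (X : 'I_d -> 'M[C]_(n, m)) v :
  qact Q X v = \sum_j smul (X j) (map_mx (Q j) v).
Proof.
apply/colP => i; rewrite mxE summxE exchange_big; apply: eq_bigr => j _.
by rewrite mxE; apply: eq_bigr => k _; rewrite mxE.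
Qed.

Lemma smul_sum G n m (S : 'M[C]_(n, m)) I (r : seq I) (P : pred I) (F : I -> 'cV[G : hilbert R]_m) :
  smul S (\sum_(i <- r | P i) F i) = \sum_(i <- r | P i) smul S (F i).
Proof. by apply: big_morph => [u v|]; rewrite ?smulDr ?smul0r. Qed.

Lemma qact_mull n m p (S : 'M[C]_(p, n)) (X : 'I_d -> 'M[C]_(n, m)) v :
  qact Q (fun j => S *m X j) v = smul S (qact Q X v).
Proof. by rewrite !qactE smul_sum; apply: eq_bigr => j _; rewrite smulA. Qed.

Lemma qactDl n m (X Y : 'I_d -> 'M[C]_(n, m)) v :
  qact Q (fun j => X j + Y j) v = qact Q X v + qact Q Y v.
Proof. by rewrite !qactE -big_split; apply: eq_bigr => j _; rewrite smulDl. Qed.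

Lemma qact0l n m v : qact Q (fun=> 0 : 'M[C]_(n, m)) v = 0.
Proof. by rewrite qactE big1 // => j _; rewrite smul0l. Qed.

Lemma qact_row_col n m p (X : 'I_d -> 'M[C]_(n, m)) (Y : 'I_d -> 'M[C]_(n, p)) v w :
  qact Q (fun j => row_mx (X j) (Y j)) (col_mx v w) = qact Q X v + qact Q Y w.
Proof.
rewrite !qactE -big_split; apply: eq_bigr => j _ /=.
by rewrite map_col_mx smul_row_col.
Qed.

Lemma qact_col n m p (X : 'I_d -> 'M[C]_(n, m)) (Y : 'I_d -> 'M[C]_(p, m)) v :
  qact Q (fun j => col_mx (X j) (Y j)) v = col_mx (qact Q X v) (qact Q Y v).
Proof.
apply/colP => i; case: (split_ordP i) => k ->.
  rewrite col_mxEu !mxE; apply: eq_bigr => l _; apply: eq_bigr => j _.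
  by rewrite col_mxEu.
rewrite col_mxEd !mxE; apply: eq_bigr => l _; apply: eq_bigr => j _.
by rewrite col_mxEd.
Qed.

Lemma qact_block n1 n2 m1 m2 (A : 'I_d -> 'M[C]_(n1, m1)) (B : 'I_d -> 'M[C]_(n1, m2))
    (A' : 'I_d -> 'M[C]_(n2, m1)) (B' : 'I_d -> 'M[C]_(n2, m2)) v w :
  qact Q (fun j => block_mx (A j) (B j) (A' j) (B' j)) (col_mx v w) =
  col_mx (qact Q A v + qact Q B w) (qact Q A' v + qact Q B' w).
Proof. by rewrite qact_col !qact_row_col. Qed.

Hypothesis linQ : forall j, linear (Q j).

Lemma qact_mulr n m p (S : 'M[C]_(m, p)) (X : 'I_d -> 'M[C]_(n, m)) v :
  qact Q (fun j => X j *m S) v = qact Q X (smul S v).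
Proof.
rewrite !qactE; apply: eq_bigr => j _; rewrite smulA; congr smul.
apply/colP => i; rewrite !mxE linear_map_sum //; apply: eq_bigr => k _.
by rewrite mxE linear_mapZ.
Qed.

Lemma qact0r n m (X : 'I_d -> 'M[C]_(n, m)) : qact Q X 0 = 0.
Proof.
by rewrite -(@smul0r _ H m 0 0) -qact_mulr [LHS]qactE big1 // => j _;
  rewrite mulmx0 smul0l.
Qed.

Lemma qactDr n m (X : 'I_d -> 'M[C]_(n, m)) v w :
  qact Q X (v + w) = qact Q X v + qact Q X w.
Proof.
rewrite !qactE -big_split; apply: eq_bigr => j _ /=; rewrite -smulDr; congr smul.
by apply/colP => i; rewrite !mxE linear_mapD.
Qed.

Lemma linear_nc_lin n (X : mtuple R d n) i k : linear (nc_lin Q X i k).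
Proof.
move=> a x y; rewrite !mxE !fct_sumE scaler_sumr -big_split; apply: eq_bigr => j _.
have -> : (X j i k *: Q j) (a *: x + y) = X j i k *: Q j (a *: x + y) by [].
by rewrite linQ scalerDr !scalerA mulrC.
Qed.

Lemma nc_ballP n (X : mtuple R d n) :
  nc_ball Q n X <-> (0 < n)%N /\ exists2 c, 0 <= c < 1 & qbound Q X c.
Proof.
have lX := linear_nc_lin X.
split=> -[n0 hX]; split=> //.
  have [r /andP[r0 r1] hr] : exists2 r : R, 0 <= r < 1 & (opmx_norm (nc_lin Q X) <= r%:E)%E.
    case: (opmx_norm (nc_lin Q X)) hX => [r| |] //= hr.
      exists (Num.max 0 r); last by rewrite lee_fin le_max lexx orbT.
      by rewrite le_max lexx /= gt_max ltr01 -lte_fin.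
    by exists 0; rewrite ?lexx ?ltr01 ?leNye.
  exists (r ^+ 2); first by rewrite sqr_ge0 expr_lt1.
  move=> v; rewrite -opmx_apply_nc_lin; move: v; apply/opmx_norm_leP; rewrite ?sqr_ge0 //.
  by rewrite sqrtr_sqr ger0_norm.
case: hX => c /andP[c0 c1] hX.
apply: (@le_lt_trans _ _ (Num.sqrt c)%:E).
  by apply/opmx_norm_leP => // v; rewrite opmx_apply_nc_lin.
by rewrite lte_fin -sqrtr1 ltr_sqrt.
Qed.

Lemma nc_cballP n (X : mtuple R d n) :
  nc_cball Q n X <-> (0 < n)%N /\ qbound Q X 1.
Proof.
have lX := linear_nc_lin X.
split=> -[n0 hX]; split=> //.
  move=> v; rewrite -opmx_apply_nc_lin; move: v; apply/opmx_norm_leP => //.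
  by rewrite sqrtr1.
rewrite -sqrtr1; apply/opmx_norm_leP => // v; rewrite opmx_apply_nc_lin.
exact: hX.
Qed.

Lemma qbound_compress n m (X : 'I_d -> 'M[C]_n) c (L : 'M[C]_(n, m)) :
  L ^t* *m L = 1%:M -> qbound Q X c -> qbound Q (fun j => L ^t* *m X j *m L) c.
Proof.
move=> LL hX v; rewrite (qact_mulr _ (fun j => L ^t* *m X j)) qact_mull.
apply: le_trans (smul_coisometry _ LL) _.
by rewrite -[X in c * X](smul_isometry v LL).
Qed.

Hypothesis boundQ : forall j, bounded_op (Q j).

Lemma qbound_exists n m (X : 'I_d -> 'M[C]_(n, m)) :
  exists2 c, 0 <= c & qbound Q X c.
Proof.
have entry i : exists2 c, 0 <= c & forall v : 'cV_m, nrm2 (qact Q X v i 0) <= c * snrm2 v.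
  pose P (f : 'cV[H]_m -> K) := exists2 c, 0 <= c & forall v, nrm2 (f v) <= c * snrm2 v.
  suff : P (\sum_k \sum_j (fun v : 'cV[H]_m => X j i k *: Q j (v k 0))).
    case=> c c0 h; exists c => // v; rewrite mxE; have := h v.
    rewrite fct_sumE; under eq_bigr do rewrite fct_sumE.
    by [].
  have PD f g : P f -> P g -> P (f + g).
    move=> [c c0 hc] [e e0 he]; exists (2 * c + 2 * e) => [|v]; first lra.
    apply: le_trans (rdotD_le _ _) _.
    have := hc v; have := he v; lra.
  have P0 : P 0 by exists 0 => // v; rewrite mul0r /= rdot0l.
  apply: (big_ind P P0 PD) => k _; apply: (big_ind P P0 PD) => j _.
  have /bounded_opP[_ [c c0 hc]] := boundQ j.
  exists (sqmod (X j i k) * c) => [|v]; first by rewrite mulr_ge0 ?sqmod_ge0.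
  rewrite nrm2Z.
  rewrite -mulrA ler_wpM2l ?sqmod_ge0 //; apply: le_trans (hc _) _; rewrite ler_wpM2l //.
  rewrite /sdot (bigD1 k) //= lerDl sumr_ge0 // => l _.
  exact: nrm2_ge0.
pose c i := s2val (cid2 (entry i)).
exists (\sum_i c i) => [|v].
  by apply: sumr_ge0 => i _; rewrite /c; case: cid2.
rewrite mulr_suml; apply: ler_sum => i _; rewrite /c; case: cid2 => ? ? /=.
exact.
Qed.

(** The diagonal leaves a margin 1 - c, part of which pays for a sufficiently small multiple of the
    corner. *)
Lemma qbound_triangle n m (P : 'I_d -> 'M[C]_n) (B : 'I_d -> 'M[C]_m)
    (E : 'I_d -> 'M[C]_(n, m)) c :
  0 <= c < 1 -> qbound Q P c -> qbound Q B c ->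
  exists t : R, 0 < t /\ exists2 c', 0 <= c' < 1 &
    qbound Q (fun j => block_mx (P j) ((t%:C%C) *: E j) 0 (B j)) c'.
Proof.
move=> /andP[c0 c1] hP hB.
have [e e0 he] := qbound_exists E.
pose ep := (1 - c) / 2.
have ep0 : 0 < ep by rewrite /ep; lra.
have ei : 0 < ep^-1 by rewrite invr_gt0.
(* [s] is t^2, tuned so that the corner costs at most a quarter of the margin; 1 + e stands for e to
   allow division. *)
have [s s0 sE] : exists2 s : R, 0 < s & (1 + ep^-1) * (s * (1 + e)) = (1 - c) / 4.
  exists ((1 - c) / 4 / ((1 + ep^-1) * (1 + e))).
    by rewrite !divr_gt0 //; first lra; rewrite mulr_gt0 //; lra.
  by rewrite mulrCA divfK // gt_eqF // mulr_gt0 //; lra.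
exists (Num.sqrt s); split; first by rewrite sqrtr_gt0.
(* This is (3 + c) / 4. It exceeds the coefficient (1 + 3 c) / 4 of |v2|^2 by (1 - c) / 2 and the
   coefficient (1 + ep) c of |v1|^2 by (3 - 2 c) (1 - c) / 4. *)
exists ((1 + 3 * c) / 4 + (1 - c) / 2); first by apply/andP; split; lra.
move=> v; rewrite -[v]vsubmxK; set v1 := usubmx v; set v2 := dsubmx v.
rewrite qact_block qact0l add0r !sdot_col.
have := hP v1; have := hB v2; have := he v2; have := snrm2_ge0 v1; have := snrm2_ge0 v2.
have -> : qact Q (fun j => (Num.sqrt s)%:C%C *: E j) v2 = smul ((Num.sqrt s)%:C%C)%:M (qact Q E v2).
  by rewrite -qact_mull; apply: eq_qact => j; rewrite mul_scalar_mx.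
have := sdotD_le (qact Q P v1) (smul ((Num.sqrt s)%:C%C)%:M (qact Q E v2)) ep0.
rewrite snrm2R sqr_sqrtr ?(ltW s0) //.
move: (snrm2 _) (snrm2 v1) (snrm2 v2) (snrm2 (qact Q P v1)) (snrm2 (qact Q E v2))
  (snrm2 (qact Q B v2)) => x1 y1 y2 p q b h0 h1 h2 h3 h4 h5.
have h6 : (1 + ep^-1) * (s * q) <= (1 - c) / 4 * y2.
  apply: (@le_trans _ _ ((1 + ep^-1) * (s * (1 + e)) * y2)); last by rewrite sE.
  rewrite -!mulrA ler_wpM2l //; first lra.
  by rewrite ler_wpM2l ?(ltW s0) //; lra.
have h7 : (1 + ep) * p <= (1 + ep) * (c * y1) by rewrite ler_wpM2l //; lra.
apply: (@le_trans _ _ ((1 + ep) * (c * y1) + (1 - c) / 4 * y2 + c * y2)); first lra.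
have k1 : 0 <= (3 - 2 * c) * (1 - c) * y1 by rewrite !mulr_ge0 //; lra.
have k2 : 0 <= (1 - c) * y2 by rewrite mulr_ge0 //; lra.
rewrite /ep; lra.
Qed.

End Qact.
End OperatorMatrices.

(** * Nc maps *)

Section NCMaps.
Variable R : realType.
Local Notation C := R[i].
Implicit Types H K : hilbert R.
Local Notation nrm2 x := (rdot x x).
Local Notation snrm2 x := (sdot x x).

(** The similarity [[1, T], [0, 1]] fixes the direct sum of A and B exactly when T intertwines them;
    it then fixes the image too, and the upper right corner gives the claim. *)
Lemma nc_map_intertwine d l (Omega : nc_subset R d) (Delta : nc_subset R l) f
    n m (A : mtuple R d n) (B : mtuple R d m) (T : 'M[C]_(n, m)) :
  nc_set Omega -> nc_map Omega Delta f -> Omega n A -> Omega m B ->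
  (forall j, A j *m T = T *m B j) -> forall j, f n A j *m T = T *m f m B j.
Proof.
move=> sO [_ fsum fconj] OA OB AT j.
pose S : 'M[C]_(n + m) := block_mx 1%:M T 0 1%:M.
have Su : S \in unitmx by rewrite unitmxE det_ublock !det1 mulr1 unitr1.
have DS : mt_conj S (mt_dsum A B) = mt_dsum A B.
  apply/ffunP => k; rewrite !ffunE -mulmxA.
  have -> : block_mx (A k) 0 0 (B k) *m S = S *m block_mx (A k) 0 0 (B k).
    by rewrite !mulmx_block !(mulmx0, mul0mx, mulmx1, mul1mx, addr0, add0r) AT.
  by rewrite mulKmx.
have := fconj _ _ _ Su (sO _ _ _ _ OA OB); rewrite DS => /(_ (sO _ _ _ _ OA OB)).
rewrite fsum // => /ffunP/(_ j); rewrite !ffunE -mulmxA => /(congr1 (mulmx S)).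
rewrite mulKVmx // !mulmx_block !(mulmx0, mul0mx, mulmx1, mul1mx, addr0, add0r).
by case/eq_block_mx.
Qed.

Lemma qbound_dr H K d (Q : 'I_d -> H -> K) n m (V : 'I_d -> 'M[C]_(n + m)) c :
  (forall j, linear (Q j)) -> qbound Q V c -> qbound Q (fun j => drsubmx (V j)) c.
Proof.
move=> lQ hV v; have := hV (col_mx 0 v).
rewrite (eq_qact Q _ (fun j => esym (submxK (V j)))) qact_block !sdot_col sdot0l add0r.
rewrite !qact0r // !add0r; apply: le_trans; rewrite lerDr; exact: snrm2_ge0.
Qed.

Section Extension.
Variables (R1 S1 R2 S2 : hilbert R) (d1 d2 : nat).
Variables (Q1 : 'I_d1 -> R1 -> S1) (Q2 : 'I_d2 -> R2 -> S2).
Hypothesis Q1_bounded : forall j, bounded_op (Q1 j).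
Hypothesis Q2_bounded : forall j, bounded_op (Q2 j).
Let linQ1 j : linear (Q1 j). Proof. by case: (Q1_bounded j). Qed.
Let linQ2 j : linear (Q2 j). Proof. by case: (Q2_bounded j). Qed.

Lemma nc_ball_dsum : nc_set (nc_ball Q1).
Proof.
move=> n m X Y /(nc_ballP linQ1)[n0 [c /andP[c0 c1] hX]].
move=> /(nc_ballP linQ1)[m0 [e /andP[e0 e1] hY]]; apply/nc_ballP => //.
split; first by rewrite addn_gt0 n0.
exists (Num.max c e); first by rewrite le_max c0 gt_max c1 e1.
apply: (@eq_qbound _ _ _ _ _ _ _ (fun j => block_mx (X j) 0 0 (Y j))) => [j|v].
  by rewrite ffunE.
rewrite -[v]vsubmxK qact_block !qact0l add0r addr0 !sdot_col mulrDr lerD //.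
  apply: le_trans (hX _) _; rewrite ler_wpM2r ?snrm2_ge0 //.
  by rewrite le_max lexx.
apply: le_trans (hY _) _; rewrite ler_wpM2r ?snrm2_ge0 //.
by rewrite le_max lexx orbT.
Qed.

Section Relative.
Variables (X : nc_subset R d1) (F0 : forall n, mtuple R d1 n -> mtuple R d2 n).
Hypothesis X_nc : nc_set X.
Hypothesis X_sub : forall n, @X n `<=` nc_ball Q1 n.
Hypothesis X_full : relatively_full X (nc_ball Q1).
Hypothesis F0_nc : nc_map X (nc_cball Q2) F0.

(* The off-diagonal block of the upper triangular form of Z can be scaled by a
   similarity, which puts the triangular form back into the ball and hence into
   X; this is why F0 induces a contraction on the quotient B. *)
Lemma nc_map_quotient n k b (Z : mtuple R d1 n) (ZK : 'I_d1 -> 'M[C]_k)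
    (E : 'I_d1 -> 'M[C]_(k, b)) (B : 'I_d1 -> 'M[C]_b) (L : 'M[C]_(n, k))
    (Sg : 'M[C]_(n, b)) (P : 'M[C]_(k + b, n)) c :
  X Z -> 0 <= c < 1 -> qbound Q1 B c ->
  L ^t* *m L = 1%:M -> P *m row_mx L Sg = 1%:M ->
  (forall j, Z j *m L = L *m ZK j) ->
  (forall j, Z j *m Sg = L *m E j + Sg *m B j) ->
  exists (G : 'I_d2 -> 'M[C]_k) (E' : 'I_d2 -> 'M[C]_(k, b)) (La : 'I_d2 -> 'M[C]_b),
    [/\ qbound Q2 La 1, forall j, F0 Z j *m L = L *m G j &
        forall j, F0 Z j *m Sg = L *m E' j + Sg *m La j].
Proof.
move=> XZ /andP[c0 c1] hB LL PI ZL ZS.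
(* The balls are empty at level 0, so empty blocks are settled apart. *)
have [kb0|kb0] := posnP (k + b).
  move/eqP: kb0; rewrite addn_eq0 => /andP[/eqP k0 /eqP b0]; subst k b.
  exists (fun=> 0), (fun=> 0), (fun=> 0); split=> [v|j|j]; last by rewrite !thinmx0.
    by rewrite qact0l sdot0l mul1r snrm2_ge0.
  by rewrite !thinmx0.
have [_ [a /andP[a0 a1] hZ]] := (nc_ballP linQ1 Z).1 (X_sub XZ).
have ZKE j : ZK j = L ^t* *m Z j *m L by rewrite -mulmxA ZL mulmxA LL mul1mx.
have hK : qbound Q1 ZK a.
  by apply: (eq_qbound _ (qbound_compress linQ1 LL hZ)) => j; rewrite ZKE.
have mx1 : 0 <= Num.max a c < 1 by rewrite le_max a0 gt_max a1 c1.
have qb_max p (Y : 'I_d1 -> 'M[C]_p) u u' : u <= u' -> qbound Q1 Y u -> qbound Q1 Y u'.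
  by move=> uu hY v; apply: le_trans (hY v) _; rewrite ler_wpM2r ?snrm2_ge0.
have [||t [t0 [c' c'1 hV]]] :=
    @qbound_triangle _ _ _ _ _ Q1_bounded _ _ ZK B E _ mx1.
- by apply: qb_max hK; rewrite le_max lexx.
- by apply: qb_max hB; rewrite le_max lexx orbT.
pose V : mtuple R d1 (k + b) := [ffun j => block_mx (ZK j) (t%:C%C *: E j) 0 (B j)].
have VB : nc_ball Q1 (k + b)%N V.
  apply/nc_ballP => //; split=> //; exists c' => //.
  by apply: eq_qbound hV => j; rewrite ffunE.
(* Scaling the columns of [Sg] by t scales the corner by t, so [It] intertwines Z with [V]; its left
   inverse gives the injectivity that fullness asks for. *)
pose It := row_mx L (t%:C%C *: Sg).
have tn0 : t%:C%C != 0 :> C by rewrite fmorph_eq0 gt_eqF.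
have PI' := PI.
have [PL PS] : usubmx P *m L = 1%:M /\ usubmx P *m Sg = 0.
  move: PI; rewrite -[P]vsubmxK mul_col_row col_mxKu scalar_mx_block.
  by case/eq_block_mx.
have [PL' PS'] : dsubmx P *m L = 0 /\ dsubmx P *m Sg = 1%:M.
  move: PI'; rewrite -[P]vsubmxK mul_col_row col_mxKd scalar_mx_block.
  by case/eq_block_mx.
have PIt : col_mx (usubmx P) (t%:C%C^-1 *: dsubmx P) *m It = 1%:M.
  rewrite mul_col_row -!scalemxAr -!scalemxAl PL PS PL' PS' !scaler0 scalerA.
  by rewrite mulfV // scale1r -scalar_mx_block.
have ZI j : It *m V j = Z j *m It.
  rewrite ffunE mul_row_block mulmx0 addr0 mul_mx_row ZL -!scalemxAr ZS.
  by rewrite -scalemxAl scalerDr.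
have XV : X V.
  apply: X_full XZ VB _ ZI => u v uv.
  by rewrite -[u]mul1mx -[v]mul1mx -PIt -!mulmxA uv.
have FV := nc_map_intertwine X_nc F0_nc XZ XV (fun j => esym (ZI j)).
(* The first k coordinates carry the restriction [ZK], itself in X by fullness; intertwining with
   their inclusion makes them invariant under [F0 V]. *)
have dl0 j : dlsubmx (F0 V j) = 0.
  have [k0|k0] := posnP k.
    by move: V {VB XV ZI FV hV} ; subst k => V; rewrite thinmx0.
  pose Kt : mtuple R d1 k := [ffun j => ZK j].
  have KB : nc_ball Q1 k Kt.
    apply/nc_ballP => //; split=> //; exists a; first exact/andP.
    by apply: eq_qbound hK => i; rewrite ffunE.
  have XK : X Kt.
    apply: (X_full XZ KB (I := L)) => [u v uv|i]; last by rewrite ffunE ZL.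
    by rewrite -[u]mul1mx -[v]mul1mx -LL -!mulmxA uv.
  have VK i : V i *m col_mx 1%:M 0 = col_mx 1%:M 0 *m Kt i.
    by rewrite !ffunE mul_block_col mul_col_mx !(mulmx0, addr0, mulmx1, mul0mx, mul1mx).
  have := nc_map_intertwine X_nc F0_nc XV XK VK j.
  rewrite -[F0 V j]submxK mul_block_col mul_col_mx !(mulmx0, addr0, mulmx1, mul0mx).
  by rewrite block_mxKdl => /eq_col_mx[].
(* The factor t is undone in the corner only; [La] is a diagonal block of a contraction. *)
exists (fun j => ulsubmx (F0 V j)), (fun j => t%:C%C^-1 *: ursubmx (F0 V j)),
  (fun j => drsubmx (F0 V j)); split.
- apply: qbound_dr => //.
  by case: F0_nc => /(_ _ _ XV)/(nc_cballP linQ2)[].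
- move=> j; have := FV j; rewrite -{1}[F0 V j]submxK dl0 mul_row_block mulmx0 addr0.
  by rewrite mul_mx_row => /eq_row_mx[].
- move=> j; have := FV j; rewrite -{1}[F0 V j]submxK dl0 mul_row_block.
  rewrite mul_mx_row => /eq_row_mx[_]; rewrite -!scalemxAr -scalemxAl => e.
  apply: (scalerI tn0); rewrite e scalerDr scalerA mulfV // scale1r.
  by [].
Qed.

End Relative.
End Extension.
End NCMaps.

(** * Moments of coefficient functionals *)

Section Moments.
Variable R : realType.
Local Notation C := R[i].
Implicit Types H K : hilbert R.
Local Notation nrm2 x := (rdot x x).
Local Notation snrm2 x := (sdot x x).

Definition wmx d n (A : mtuple R d n) (w : seq 'I_d) : 'M[C]_n :=
  foldr (fun j M => A j *m M) 1%:M w.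

Lemma wmx_rcons d n (A : mtuple R d n) w j : wmx A (rcons w j) = wmx A w *m A j.
Proof.
by elim: w => [|i w IH] /=; rewrite ?mulmx1 ?mul1mx // IH mulmxA.
Qed.

Definition prow H n (al : 'cV[H]_n) (s : H) : 'rV[C]_n := \row_i hdot H s (al i 0).

Lemma hdotZr H (a : C) (x y : H) : hdot H x (a *: y) = a^* * hdot H x y.
Proof. by rewrite linearZr_LR. Qed.

Lemma hdot_sumr H I (r : seq I) (P : pred I) (F : I -> H) y :
  hdot H y (\sum_(i <- r | P i) F i) = \sum_(i <- r | P i) hdot H y (F i).
Proof.
apply: (big_morph (hdot H y)) => [u v|]; [exact: linearDr|exact: linear0r].
Qed.

Lemma prow_smul H n m (S : 'M[C]_(n, m)) (al : 'cV[H]_m) s :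
  prow (smul S al) s = prow al s *m S ^t*.
Proof.
apply/rowP => i; rewrite !mxE hdot_sumr; apply: eq_bigr => k _.
by rewrite hdotZr !mxE mulrC.
Qed.

Lemma prow_inj H n (al be : 'cV[H]_n) : prow al =1 prow be -> al = be.
Proof.
move=> ab; apply/colP => i; apply: rdot_ext => z; rewrite rdotC (rdotC _ z).
by have /rowP/(_ i) := ab z; rewrite !mxE /rdot => ->.
Qed.

(* The moments of the coefficient functional of A with coefficient vectors [al]
   and [be]: a finite-rank operator for every word. *)
Definition tens d H K n (A : mtuple R d n) (al : 'cV[K]_n) (be : 'cV[H]_n) :
    seq 'I_d -> K -> H :=
  fun w s => smul (prow al s *m wmx A w) be 0 0.

Lemma smul_row H n m (S : 'M[C]_(n, m)) (v : 'cV[H]_m) i :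
  smul S v i 0 = smul (row i S) v 0 0.
Proof. by rewrite !mxE; apply: eq_bigr => k _; rewrite mxE. Qed.

Section KeyLemma.
Variables (R1 S1 R2 S2 : hilbert R) (d1 d2 : nat).
Variables (Q1 : 'I_d1 -> R1 -> S1) (Q2 : 'I_d2 -> R2 -> S2).
Hypothesis Q1_bounded : forall j, bounded_op (Q1 j).
Hypothesis Q2_bounded : forall j, bounded_op (Q2 j).
Let linQ1 j : linear (Q1 j). Proof. by case: (Q1_bounded j). Qed.
Let linQ2 j : linear (Q2 j). Proof. by case: (Q2_bounded j). Qed.
Variables (X : nc_subset R d1) (F0 : forall n, mtuple R d1 n -> mtuple R d2 n).
Hypothesis X_nc : nc_set X.
Hypothesis X_sub : forall n, @X n `<=` nc_ball Q1 n.
Hypothesis X_full : relatively_full X (nc_ball Q1).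
Hypothesis F0_nc : nc_map X (nc_cball Q2) F0.

(* A functional carried both by Z in X and by A in the ball is carried by a
   common subquotient B of Z and A, on which F0 induces a contraction. *)
Lemma coefficient_functional_bound n m (Z : mtuple R d1 n) (A : mtuple R d1 m)
    (al : 'cV[S2]_n) (be : 'cV[R2]_n) (al' : 'cV[S2]_m) (be' : 'cV[R2]_m) :
  X Z -> nc_ball Q1 m A -> tens Z al be = tens A al' be' ->
  2 * sdot (qact Q2 (F0 Z) be) al <= snrm2 al' + snrm2 be'.
Proof.
move=> XZ /(nc_ballP linQ1)[m0 [c c01 hA]] tE.
(* Each row pairs the functionals given by one word and one vector at Z and at A. Equality of the
   moments says that all these rows vanish on (be, be'). *)
pose D (u : 'rV[C]_(n + m)) := exists w s,
  u = row_mx (prow al s *m wmx Z w) (- (prow al' s *m wmx A w)).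
have [p [M [DM subM]]] := row_sample D.
pose M1 := lsubmx M; pose M2 := - rsubmx M.
have ME : M = row_mx M1 (- M2) by rewrite opprK hsubmxK.
have Mbe : smul M1 be = smul M2 be'.
  apply/colP => i; rewrite smul_row (smul_row M2).
  have [w [s]] := DM i; rewrite ME row_row_mx => /eq_row_mx[-> e2].
  have -> : row i M2 = prow al' s *m wmx A w.
    by apply: oppr_inj; rewrite -e2; apply/rowP => k; rewrite !mxE.
  by have := congr1 (fun f => f w s) tE.
(* Appending a letter to the word keeps a row in [D]; one and the same [K] therefore describes the
   shift for Z and for A. *)
have Mshift j : exists K : 'M[C]_p, M1 *m Z j = K *m M1 /\ M2 *m A j = K *m M2.
  have /submxP[K] : (M *m block_mx (Z j) 0 0 (A j) <= M)%MS.
    apply/row_subP => i; apply: subM; have [w [s e]] := DM i.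
    exists (rcons w j), s; rewrite row_mul e mul_row_block !mulmx0 addr0 add0r.
    by rewrite mulNmx !wmx_rcons !mulmxA.
  rewrite {1 2}ME mul_row_block !mulmx0 addr0 add0r mul_mx_row => /eq_row_mx[e1 e2].
  by exists K; split=> //; move: e2; rewrite mulNmx mulmxN => /oppr_inj.
have Mprow s : exists e : 'rV[C]_p, prow al s = e *m M1 /\ prow al' s = e *m M2.
  have /submxP[e] : (row_mx (prow al s) (- prow al' s) <= M)%MS.
    by apply: subM; exists [::], s; rewrite /= !mulmx1.
  rewrite ME mul_mx_row => /eq_row_mx[e1 e2]; exists e; split=> //.
  by move: e2; rewrite mulmxN => /oppr_inj.
have [k [L [N [b [J [Sg [Om [Th [[LL M1L LN] JJ MS JO [ThM ThE]]]]]]]]]] :=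
  common_range M1 M2.
have kerL q (Y : 'M[C]_(n, q)) : M1 *m Y = 0 -> Y = L *m (L ^t* *m Y).
  move=> MY; apply/eqP; rewrite -subr_eq0 mulmxA -{1}[Y]mul1mx -mulmxBl LN.
  by rewrite -mulmxA MY mulmx0.
(* A compression of A, hence inside the ball; through [Sg] it also is the action of Z modulo ker
   M1. *)
pose B j := J ^t* *m A j *m J.
have hB : qbound Q1 B c by exact: qbound_compress.
pose P2 := Om *m M1.
have P2S : P2 *m Sg = 1%:M by rewrite -mulmxA MS mulmxA -JO.
have P2L : P2 *m L = 0 by rewrite -mulmxA M1L mulmx0.
have PI : col_mx (L ^t* - L ^t* *m Sg *m P2) P2 *m row_mx L Sg = 1%:M.
  rewrite mul_col_row !mulmxBl LL -!(mulmxA _ P2) P2S P2L !mulmx0 mulmx1.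
  by rewrite subr0 subrr -scalar_mx_block.
have ZL j : Z j *m L = L *m (L ^t* *m (Z j *m L)).
  by apply: kerL; have [K [e _]] := Mshift j; rewrite mulmxA e -mulmxA M1L mulmx0.
(* The difference Z Sg - Sg B is killed by M1: apply [Th] to M2 A J, whose range lies in ran M1 by
   [Mshift]. *)
have ZS j : Z j *m Sg = L *m (L ^t* *m (Z j *m Sg - Sg *m B j)) + Sg *m B j.
  rewrite -kerL ?subrK // mulmxBr; have [K [e1 e2]] := Mshift j.
  have M2AJ : M2 *m A j *m J = K *m M1 *m Sg by rewrite e2 -!mulmxA MS.
  have : (M2 - M2 *m J *m J ^t*) *m (A j *m J) = 0.
    by rewrite ThE -!mulmxA (mulmxA M2) M2AJ -e1 !mulmxA ThM !mul0mx.
  rewrite mulmxBl !mulmxA M2AJ -e1 => /eqP.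
  by rewrite subr_eq0 => /eqP ->; rewrite MS subrr.
have [G [E' [La [hLa FL FS]]]] :=
  nc_map_quotient Q1_bounded Q2_bounded X_nc X_sub X_full F0_nc XZ c01 hB LL PI ZL ZS.
have [ga gaE] : exists ga, ga = smul (J ^t*) be' by exists (smul (J ^t*) be').
(* Since M1 be = M2 be' lies in both ranges, be and Sg [ga] differ by an element of ker M1 = ran
   L. *)
have [ka beE] : exists ka, be = smul L ka + smul Sg ga.
  exists (smul (L ^t*) (be - smul Sg ga)).
  apply/eqP; rewrite -subr_eq; apply/eqP; set x := be - _.
  have Mx : smul M1 x = 0.
    rewrite smulDr smulNr Mbe -smulA MS gaE -smulA -smulNl -smulDl ThE.
    by rewrite smulA -Mbe -smulA ThM smul0l.
  apply/eqP; rewrite -subr_eq0 -smulA -{1}[x]smul1 -smulNl -smulDl LN smulA Mx.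
  by rewrite smul0r.
(* By the empty word, every [prow al s] lies in the row space of M1, which kills L. *)
have Lal : smul (L ^t*) al = 0.
  apply: prow_inj => s; rewrite prow_smul trmxCK; have [e [-> _]] := Mprow s.
  rewrite -mulmxA M1L mulmx0; apply/rowP => i.
  by rewrite !mxE linear0r.
have Sal : smul (Sg ^t*) al = smul (J ^t*) al'.
  apply: prow_inj => s; rewrite !prow_smul !trmxCK; have [e [-> ->]] := Mprow s.
  by rewrite -!mulmxA MS.
have sE : sdot (qact Q2 (F0 Z) be) al = sdot (qact Q2 La ga) (smul (J ^t*) al').
  rewrite {1}beE qactDr // -!qact_mulr // (eq_qact _ _ FL) (eq_qact _ _ FS).
  rewrite qactDl !qact_mull !sdotDl !sdot_smul Lal !sdot0r !add0r Sal.
  by [].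
rewrite sE; apply: le_trans (sdot_le _ _) _; rewrite addrC lerD ?smul_coisometry //.
by apply: le_trans (hLa _) _; rewrite mul1r gaE smul_coisometry.
Qed.

End KeyLemma.

(* For small t the matrix [[A, t (A T - T B)], [0, B]] is similar to A (+) B
   and lies in the ball, so its image is a contraction; this bounds
   F(A) T - T F(B) by the defect of F(B). *)
Lemma nc_map_strict H1 K1 H2 K2 d1 d2 (Q1 : 'I_d1 -> H1 -> K1) (Q2 : 'I_d2 -> H2 -> K2)
    (F : forall n, mtuple R d1 n -> mtuple R d2 n) n m
    (A : mtuple R d1 n) (B : mtuple R d1 m) :
  (forall j, bounded_op (Q1 j)) -> (forall j, bounded_op (Q2 j)) ->
  nc_map (nc_ball Q1) (nc_cball Q2) F ->
  nc_ball Q1 n A -> nc_ball Q1 m B -> nc_ball Q2 n (F n A) -> nc_ball Q2 m (F m B).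
Proof.
move=> bQ1 bQ2 Fnc bA bB.
have linQ1 j : linear (Q1 j) by case: (bQ1 j).
have linQ2 j : linear (Q2 j) by case: (bQ2 j).
move=> /(nc_ballP linQ2)[n0 [c /andP[c0 c1] hFA]].
have [m0 _] := (nc_ballP linQ1 B).1 bB.
have defect (T : 'M[C]_(n, m)) : exists2 r, 0 <= r & forall v,
    snrm2 (smul T (qact Q2 (F m B) v) - qact Q2 (F n A) (smul T v)) <=
      r * (snrm2 v - snrm2 (qact Q2 (F m B) v)).
  have [_ [a /andP[a0 a1] hA]] := (nc_ballP linQ1 A).1 bA.
  have [_ [b /andP[b0 b1] hB]] := (nc_ballP linQ1 B).1 bB.
  have qb_max p (Y : 'I_d1 -> 'M[C]_p) u u' : u <= u' -> qbound Q1 Y u -> qbound Q1 Y u'.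
    by move=> uu hY v; apply: le_trans (hY v) _; rewrite ler_wpM2r ?snrm2_ge0.
  have mx1 : 0 <= Num.max a b < 1 by rewrite le_max a0 gt_max a1 b1.
  have [||t [t0 [c' c'1 hV]]] :=
      @qbound_triangle _ _ _ _ _ bQ1 _ _ A B (fun j => A j *m T - T *m B j) _ mx1.
  - by apply: qb_max hA; rewrite le_max lexx.
  - by apply: qb_max hB; rewrite le_max lexx orbT.
  pose V : mtuple R d1 (n + m) :=
    [ffun j => block_mx (A j) (t%:C%C *: (A j *m T - T *m B j)) 0 (B j)].
  have VB : nc_ball Q1 (n + m)%N V.
    apply/nc_ballP => //; split=> //; first by rewrite addn_gt0 n0.
    by exists c' => //; apply: eq_qbound hV => j; rewrite ffunE.
  pose S : 'M[C]_(n + m) := block_mx 1%:M (t%:C%C *: T) 0 1%:M.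
  have ABS j : mt_dsum A B j *m S = S *m V j.
    rewrite !ffunE !mulmx_block !(mulmx0, mul0mx, mulmx1, mul1mx, addr0, add0r).
    by rewrite scalerBr -!scalemxAr -scalemxAl subrK.
  have := nc_map_intertwine (nc_ball_dsum bQ1) Fnc (nc_ball_dsum bQ1 bA bB) VB ABS.
  have [_ -> // _] := Fnc => FV.
  have FVE j : F (n + m)%N V j =
      block_mx (F n A j) (t%:C%C *: (F n A j *m T - T *m F m B j)) 0 (F m B j).
    move: (FV j); rewrite ffunE -[F (n + m)%N V j]submxK !mulmx_block.
    rewrite !(mulmx0, mul0mx, mulmx1, mul1mx, addr0, add0r).
    case/eq_block_mx => + + e3 e4; rewrite -e3 -e4 mulmx0 addr0 => <- e2.
    by congr block_mx; rewrite scalerBr scalemxAr e2 scalemxAl addrK.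
  have hFV : qbound Q2 (F (n + m)%N V) 1.
    by case: Fnc => /(_ _ _ VB)/(nc_cballP linQ2)[].
  (* Applied to (0, v), the contraction F(V) has lower part F(B) v and upper part t (F(A) T - T
     F(B)) v; the upper one has at most |v|^2 - |F(B) v|^2 left. *)
  exists (t ^- 2) => [|v]; first by rewrite invr_ge0 sqr_ge0.
  rewrite ler_pdivlMl ?exprn_gt0 //.
  have := hFV (col_mx 0 v); rewrite (eq_qact _ _ FVE) qact_block !sdot_col sdot0l.
  rewrite !qact0r // !add0r mul1r.
  have -> : qact Q2 (fun j => t%:C%C *: (F n A j *m T - T *m F m B j)) v =
      smul (t%:C%C)%:M (- (smul T (qact Q2 (F m B) v) - qact Q2 (F n A) (smul T v))).
    rewrite opprB -qact_mulr // -smulNl -qact_mull -qactDl -qact_mull.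
    by apply: eq_qact => j; rewrite mul_scalar_mx mulNmx.
  rewrite snrm2R sdotNl sdotNr opprK; lra.
(* [T k] moves coordinate k to the fixed position [i0], so that the squared norms over all k add up
   to that of the whole column. *)
pose i0 := Ordinal n0; pose T k : 'M[C]_(n, m) := delta_mx i0 k.
have Tnrm G (u : 'cV[G : hilbert R]_m) : \sum_k snrm2 (smul (T k) u) = snrm2 u.
  apply: eq_bigr => k _; rewrite /sdot (bigD1 i0) //= big1 => [|i ii0].
    rewrite addr0 mxE (bigD1 k) //= mxE !eqxx scale1r big1 ?addr0 // => l lk.
    by rewrite mxE (negPf lk) andbF scale0r.
  rewrite mxE big1 ?rdot0l // => l _.
  by rewrite mxE (negPf ii0) scale0r.
pose r k := s2val (cid2 (defect (T k))).
have r0 k : 0 <= r k by rewrite /r; case: cid2.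
have hr k v : snrm2 (smul (T k) (qact Q2 (F m B) v) - qact Q2 (F n A) (smul (T k) v)) <=
      r k * (snrm2 v - snrm2 (qact Q2 (F m B) v)).
  by rewrite /r; case: cid2.
(* With this choice (1 + e) c = 1 - (1 - c)^2 < 1. *)
pose e := 1 - c; have e0 : 0 < e by rewrite subr_gt0.
have ei : 0 < e^-1 by rewrite invr_gt0.
pose Mb := (1 + e^-1) * \sum_k r k.
have Mb0 : 0 <= Mb by rewrite mulr_ge0 ?sumr_ge0 //; lra.
have ec : (1 + e) * c < 1.
  have : 0 < (1 - c) * (1 - c) by rewrite mulr_gt0 // subr_gt0.
  rewrite /e; lra.
(* Obtained by solving x <= (1 + e) c |v|^2 + Mb (|v|^2 - x) for x = |F(B) v|^2. *)
apply/nc_ballP => //; split=> //; exists (((1 + e) * c + Mb) / (1 + Mb)).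
  rewrite divr_ge0 ?ltr_pdivrMr ?mul1r; [|lra|nra|lra].
  by rewrite ltrD2r.
move=> v; rewrite mulrAC ler_pdivlMr; last lra.
set x := snrm2 (qact _ _ _).
suff : x <= (1 + e) * c * snrm2 v + Mb * (snrm2 v - x) by lra.
have -> : Mb * (snrm2 v - x) = \sum_k (1 + e^-1) * (r k * (snrm2 v - x)).
  by rewrite -mulr_sumr -mulr_suml mulrA.
rewrite -(Tnrm _ v) mulr_sumr -big_split /x -Tnrm /=; apply: ler_sum => k _.
rewrite !Tnrm.
set y := smul (T k) (qact _ _ v); set z := qact Q2 (F n A) (smul (T k) v).
have -> : y = z + (y - z) by rewrite addrC subrK.
apply: le_trans (sdotD_le _ _ e0) _; apply: lerD.
  rewrite -mulrA ler_wpM2l //; last exact: hFA.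
  lra.
rewrite ler_wpM2l //; first lra.
exact: hr.
Qed.

End Moments.

(** * The Hahn-Banach and Riesz theorems *)

Section Functionals.
Variable R : realType.
Local Notation C := R[i].
Local Notation nrm2 x := (rdot x x).

Section HahnBanach.
Variable V : lmodType C.
Implicit Types (S : set (V * R)) (u v x : V) (a r : R).

(** Partial functionals are graphs, that is, sets of pairs (vector, value). Being single-valued is
    not part of the definition; it follows from domination. *)
Definition real_subspace S :=
  forall a u v r s, S (u, r) -> S (v, s) -> S (a%:C%C *: u + v, a * r + s).

Variables (D : set (V * R)) (S0 : set (V * R)).
Hypothesis DD : forall u v r s, D (u, r) -> D (v, s) -> D (u + v, r + s).
Hypothesis DZ : forall a u r, 0 < a -> D (u, r) -> D (a%:C%C *: u, a * r).
Hypothesis DN : forall u r, D (u, r) -> exists s, D (- u, s).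
Hypothesis D0 : D (0, 0).
Hypothesis S0_sub : real_subspace S0.
Hypothesis S0_neq0 : S0 !=set0.

(** [D] consists of the pairs (vector, admissible bound), so no infimum is taken. Vectors without a
    bound are allowed; [DN] makes the bounded ones symmetric. *)
Definition dominated S := forall v r c, S (v, r) -> D (v, c) -> r <= c.

Hypothesis S0_dom : dominated S0.

Lemma real_subspace0 S : S !=set0 -> real_subspace S -> S (0, 0).
Proof.
move=> [[v r] Sv] lS; have := lS (-1) _ _ _ _ Sv Sv.
by rewrite rmorphN1 scaleN1r addNr mulN1r addNr.
Qed.

Lemma real_subspaceZ S a v r : S !=set0 -> real_subspace S -> S (v, r) ->
  S (a%:C%C *: v, a * r).
Proof.
by move=> S1 lS Sv; have := lS a _ _ _ _ Sv (real_subspace0 S1 lS); rewrite !addr0.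
Qed.

Lemma hahn_banach_step S x : S !=set0 -> real_subspace S -> dominated S ->
  exists k, dominated [set z | exists a v r,
    S (v, r) /\ z = (v + a%:C%C *: x, r + a * k)].
Proof.
move=> S1 lS dS.
(* The lower bounds imposed on the value [k] at x; [cross] compares them with the upper ones. *)
pose A := [set y : R | exists u r c, [/\ S (u, r), D (u - x, c) & y = r - c]].
have cross u r c u' r' c' : S (u, r) -> D (u - x, c) -> S (u', r') ->
    D (u' + x, c') -> r - c <= c' - r'.
  move=> Su Du Su' Du'.
  have /dS : S (u + u', r + r').
    by have := lS 1 _ _ _ _ Su Su'; rewrite rmorph1 scale1r mul1r.
  have := DD Du Du'; rewrite addrACA addNr addr0 => h /(_ _ h); lra.
have [k [k1 k2]] : exists k,
    (forall u r c, S (u, r) -> D (u - x, c) -> r - k <= c) /\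
    (forall u r c, S (u, r) -> D (u + x, c) -> r + k <= c).
  have [A0|A0] := pselect (A !=set0).
    exists (sup A); split=> u r c Su Du.
      have : r - c <= sup A.
        apply: ub_le_sup; last by exists u, r, c.
        have [s Ds] := DN Du.
        have Su' := real_subspaceZ (-1) S1 lS Su.
        exists (s - (-1 * r)) => _ [v [r' [c' [Sv Dv ->]]]].
        apply: cross Sv Dv Su' _; move: Ds.
        by rewrite opprB rmorphN1 scaleN1r addrC.
      lra.
    have : sup A <= c - r.
      apply: ge_sup => // _ [v [r' [c' [Sv Dv ->]]]].
      exact: cross Sv Dv Su Du.
    lra.
  (* Without lower bounds there are, by [DN], no upper bounds either, so any value serves. *)
  exists 0; split=> u r c Su Du; exfalso; apply: A0.
    by exists (r - c), u, r, c.
  have [s Ds] := DN Du; exists (-1 * r - s), (- u), (-1 * r), s; split=> //.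
    by have := real_subspaceZ (-1) S1 lS Su; rewrite rmorphN1 scaleN1r.
  by rewrite -opprD.
exists k => _ _ c [a [v [r [Sv [-> ->]]]]] Dv.
have [a0|a0|a0] := ltgtP a 0.
- have b0 : 0 < - a^-1 by rewrite oppr_gt0 invr_lt0.
  have Dv' := DZ b0 Dv; have Sv' := real_subspaceZ (- a^-1) S1 lS Sv.
  move: Dv'; rewrite scalerDr scalerA -rmorphM mulNr mulVf ?lt_eqF //.
  rewrite rmorphN1 scaleN1r => /(k1 _ _ _ Sv') h.
  have := ler_wpM2l (ltW (_ : 0 < - a)) h; rewrite oppr_gt0 => /(_ a0).
  rewrite mulrBr !mulrA !mulrNN mulfV ?lt_eqF // !mul1r; lra.
- have b0 : 0 < a^-1 by rewrite invr_gt0.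
  have Dv' := DZ b0 Dv; have Sv' := real_subspaceZ a^-1 S1 lS Sv.
  move: Dv'; rewrite scalerDr scalerA -rmorphM mulVf ?gt_eqF //.
  rewrite rmorph1 scale1r => /(k2 _ _ _ Sv') h.
  have := ler_wpM2l (ltW a0) h.
  by rewrite mulrDr !mulrA mulfV ?gt_eqF // !mul1r.
- move: Dv; rewrite a0 scale0r mul0r !addr0; exact: dS.
Qed.

Lemma hahn_banach : exists f : V -> R,
  [/\ forall a u v, f (a%:C%C *: u + v) = a * f u + f v,
      forall v r, S0 (v, r) -> f v = r &
      forall v c, D (v, c) -> f v <= c].
Proof.
(* Joining [S0] makes the empty chain admissible for Zorn's lemma. *)
pose P S := real_subspace (S0 `|` S) /\ dominated (S0 `|` S).
have [|S [[lS dS] maxS]] := @Zorn_bigcup _ P.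
  move=> F FP totF; split; last first.
    move=> v r c [Sv|[A FA Av]]; first exact: S0_dom.
    by have [_] := FP _ FA; apply; right.
  have up A z : F A -> (S0 `|` A) z -> (S0 `|` \bigcup_(B in F) B) z.
    by move=> FA [?|?]; [left|right; exists A].
  move=> a u v r s [Su|[A FA Au]] [Sv|[B FB Bv]].
  - by left; apply: S0_sub.
  - by apply: (up B) => //; apply: (FP _ FB).1; [left|right].
  - by apply: (up A) => //; apply: (FP _ FA).1; [right|left].
  - have [AB|BA] := totF _ _ FA FB.
      by apply: (up B) => //; apply: (FP _ FB).1; right => //; apply: AB.
    by apply: (up A) => //; apply: (FP _ FA).1; right => //; apply: BA.
set M := S0 `|` S in lS dS.
have M1 : M !=set0 by have [z Sz] := S0_neq0; exists z; left.
have M0 := real_subspace0 M1 lS.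
(* Two values at v put (0, s - r) into [M], hence also (0, (s - r)^2), which the bound 0 at 0 forces
   to vanish. *)
have uniq v r s : M (v, r) -> M (v, s) -> r = s.
  move=> Mr Ms; have := lS (-1) _ _ _ _ Mr Ms.
  rewrite rmorphN1 scaleN1r addNr => M2.
  have := real_subspaceZ (-1 * r + s) M1 lS M2; rewrite scaler0 => /dS/(_ D0).
  rewrite mulN1r => h; have : (- r + s) ^+ 2 <= 0 by rewrite expr2.
  by rewrite real_exprn_even_le0 ?num_real //= addrC subr_eq0 => /eqP.
have total v : exists r, M (v, r).
  apply: contrapT => nM; have [k dk] := hahn_banach_step v M1 lS dS.
  set N := [set z | _] in dk.
  have MN : M `<=` N.
    move=> [u r] Mu; exists 0, u, r; split=> //.
    by rewrite scale0r mul0r !addr0.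
  have S0N : S0 `|` N = N by apply/setUidPr => z Sz; apply: MN; left.
  apply: (maxS N); last first.
    rewrite /P S0N; split=> // a _ _ _ _ [b [u [r [Mu [-> ->]]]]] [b' [u' [r' [Mu' [-> ->]]]]].
    exists (a * b + b'), (a%:C%C *: u + u'), (a * r + r'); split; first exact: lS.
    rewrite scalerDr scalerA rmorphD rmorphM scalerDl; congr (_, _).
      by rewrite addrACA.
    by ring.
  split; first by move=> z Sz; apply: MN; right.
  move=> /(_ (v, k)) NS; apply: nM; exists k; right; apply: NS.
  by exists 1, 0, 0; split=> //; rewrite rmorph1 scale1r mul1r !add0r.
have [f fM] := choice total; exists f; split.
- move=> a u v; apply: uniq (fM _) _; exact: lS.
- by move=> v r Sv; apply: uniq (fM _) _; left.
- by move=> v c Dv; apply: dS (fM v) Dv.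
Qed.

End HahnBanach.

Section Riesz.
Variable H : hilbert R.

(** The limit is described by members of the filter near it, so the Riesz argument can work with
    near-minimisers without continuity of [phi]. *)
Lemma hilbert_cauchy (F : set_system H) : ProperFilter F ->
  (forall e, 0 < e -> exists x, F [set y | nrm2 (x - y) < e]) ->
  exists y, forall e A, 0 < e -> F A -> exists2 x, A x & nrm2 (y - x) < e.
Proof.
move=> FF Fc.
have cF : cauchy F.
  apply: cauchy_exP => e e0.
  have eE : e = (complex.Re e)%:C%C by rewrite RRe_real // gtr0_real.
  have r0 : 0 < complex.Re e by rewrite -ltcR -eE.
  have [x Fx] := Fc _ (exprn_gt0 2 r0); exists x; apply: filterS Fx => y /= xy.
  rewrite -ball_normE /= hilbert_normE eE ltcR.
  by rewrite -(ltr_pXn2r (n := 2)) ?nnegrE ?sqrtr_ge0 ?(ltW r0) // sqr_sqrtr ?nrm2_ge0.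
have Fy : F --> lim F by exact: cauchy_cvg.
exists (lim F) => e A e0 FA.
have FB : F (ball (lim F) (Num.sqrt e)%:C%C).
  by apply: Fy; apply: nbhsx_ballx; rewrite ltcR sqrtr_gt0.
have [x [Ax]] := filter_ex (filterI FA FB); rewrite -ball_normE /= hilbert_normE ltcR.
by move=> yx; exists x => //; rewrite -ltr_sqrt.
Qed.

(* [phi] is represented by the minimiser of |x|^2 / 2 - phi x. *)
Lemma riesz (phi : H -> R) (c : R) :
  (forall a x y, phi (a%:C%C *: x + y) = a * phi x + phi y) ->
  (forall x, phi x <= nrm2 x / 2 + c) ->
  exists y, forall x, phi x = rdot x y.
Proof.
move=> lphi bphi.
pose J x := nrm2 x / 2 - phi x.
pose m := inf (range J).
have hI : has_inf (range J).
  split; first by exists (J 0), 0.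
  by exists (- c) => _ [x _ <-]; rewrite /J; have := bphi x; lra.
have Jm x : m <= J x by apply: ge_inf; [exact: hI.2|exists x].
have Jline a x y : J (a%:C%C *: x + y) =
    J y + a * (rdot x y - phi x) + a ^+ 2 * nrm2 x / 2.
  rewrite /J lphi !(rdotDl, rdotDr, rdotRl, rdotRr) (rdotC y x); lra.
(* The parallelogram law, with J at the midpoint; it makes near-minimisers a Cauchy filter, e / 8
   leading to distance e. *)
have gap x y : nrm2 (x - y) = 4 * (J x + J y - 2 * J ((2^-1)%:C%C *: (x - y) + y)).
  rewrite Jline /J.
  have -> : phi (x - y) = phi x - phi y.
    by have := lphi (-1) y x; rewrite rmorphN1 scaleN1r addrC => ->; lra.
  by rewrite !(rdotDl, rdotDr, rdotNl, rdotNr) (rdotC y x); field.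
pose F := filter_from [set e : R | 0 < e] (fun e => [set x | J x < m + e]).
have FF : ProperFilter F.
  apply: filter_from_proper; last first.
    by move=> e e0; have [_ [x _ <-] xe] := inf_adherent e0 hI; exists x.
  apply: filter_from_filter; first by exists 1; rewrite /=.
  move=> e e' e0 e'0; exists (Num.min e e') => /=; first by rewrite lt_min e0.
  move=> x /= xe; split; apply: (lt_le_trans xe); rewrite lerD2l ge_min lexx ?orbT //.
have [e e0|y hy] := hilbert_cauchy FF.
  have e8 : 0 < e / 8 by rewrite divr_gt0.
  have [_ [x0 _ <-] xe] := inf_adherent e8 hI; exists x0; exists (e / 8) => //= y ye.
  move: ye => /= ye; rewrite gap; have := Jm ((2^-1)%:C%C *: (x0 - y) + y); move: xe ye; rewrite -/m; lra.
exists y => z; apply/eqP; rewrite eq_sym -subr_eq0; apply/eqP.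
set g := rdot z y - phi z.
have hg t : 0 <= t * g + t ^+ 2 * nrm2 z.
  rewrite leNgt; apply/negP => neg.
  (* Replacing y by a near-minimiser x costs at most 3 e / 2, less than the deficit 2 e. Half of t^2
     |z|^2 comes from J, half from the product of z and y - x. *)
  pose e := - (t * g + t ^+ 2 * nrm2 z) / 2.
  have e0 : 0 < e by rewrite /e divr_gt0 // oppr_gt0.
  have [|x /= xe yx] := hy e [set x | J x < m + e] e0; first by exists e.
  have := Jm (t%:C%C *: z + x); rewrite Jline.
  have := rdot_le ((- t)%:C%C *: z) (y - x).
  rewrite !rdotRl rdotRr rdotDr rdotNr.
  move: xe yx neg; rewrite /e /g; lra.
have zz := nrm2_ge0 z.
(* At t = - s g the expression in [hg] equals - (s g)^2, so g = 0; the 1 covers z = 0. *)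
pose s := (1 + nrm2 z)^-1.
have s0 : 0 < s by rewrite invr_gt0; lra.
have := hg (- s * g).
have -> : - s * g * g + (- s * g) ^+ 2 * nrm2 z = - (s * g) ^+ 2.
  have : s * (1 + nrm2 z) = 1 by rewrite mulVf // gt_eqF //; lra.
  move=> h; apply/eqP; rewrite -subr_eq0.
  have -> : - s * g * g + (- s * g) ^+ 2 * nrm2 z - - (s * g) ^+ 2 =
    s * g ^+ 2 * (s * (1 + nrm2 z) - 1) by ring.
  by rewrite h subrr mulr0.
rewrite oppr_ge0 real_exprn_even_le0 ?num_real //= mulf_eq0 gt_eqF //=.
by move/eqP.
Qed.

End Riesz.
End Functionals.

(** * Operator spaces *)

Section OperatorSpaces.
Variable R : realType.
Local Notation C := R[i].
Implicit Types H K : hilbert R.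
Local Notation nrm2 x := (rdot x x).
Local Notation snrm2 x := (sdot x x).

Lemma bounded_op0 H K : bounded_op (0 : H -> K).
Proof.
apply/bounded_opP; split=> [a x y|]; first by rewrite scaler0 addr0.
by exists 0 => // x; rewrite mul0r rdot0l.
Qed.

Lemma bounded_op_lin H K (a : C) (S T : H -> K) :
  bounded_op S -> bounded_op T -> bounded_op (a *: S + T).
Proof.
move=> /bounded_opP[lS [c c0 hS]] /bounded_opP[lT [e e0 hT]].
apply/bounded_opP; split=> [b x y|].
  have E z : (a *: S + T) z = a *: S z + T z by [].
  rewrite !E lS lT !scalerDr !scalerA (mulrC a) -!addrA; congr (_ + _).
  by rewrite addrCA.
exists (2 * (sqmod a * c) + 2 * e) => [|x].
  by rewrite addr_ge0 ?mulr_ge0 // sqmod_ge0.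
apply: le_trans (rdotD_le _ _) _; rewrite [leRHS]mulrDl lerD //; last first.
  by rewrite -mulrA ler_wpM2l.
by rewrite nrm2Z -!mulrA ler_wpM2l // ler_wpM2l // sqmod_ge0.
Qed.

Lemma bounded_op_sum H K I (r : seq I) (a : I -> C) (T : I -> H -> K) :
  (forall i, bounded_op (T i)) -> bounded_op (\sum_(i <- r) a i *: T i).
Proof.
move=> bT; elim: r => [|i r IH]; first by rewrite big_nil; apply: bounded_op0.
by rewrite big_cons; apply: bounded_op_lin.
Qed.

Lemma operator_space_bounded H K : operator_space (@bounded_op R H K).
Proof.
split=> //; first exact: bounded_op0.
by move=> a S T bS bT; apply: bounded_op_lin.
Qed.

(** Cauchy-Schwarz, with 1 added so that s = 0 is no special case. *)
Lemma sqmod_hdot_le K (x s : K) : sqmod (hdot K x s) <= (nrm2 s + 1) * nrm2 x.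
Proof.
set z := hdot K x s.
have zE : rdot x (z *: s) = sqmod z.
  apply: complexI; rewrite /sqmod add_Re2_Im2 /rdot hdotZr -/z.
  by rewrite mulrC -normCK RRe_real // ger0_real // exprn_ge0.
have l0 : 0 < nrm2 s + 1 by have := nrm2_ge0 s; lra.
have := nrm2_ge0 ((nrm2 s + 1)%:C%C *: x - z *: s).
rewrite !(rdotDl, rdotDr, rdotNl, rdotNr, rdotRl, rdotRr) (rdotC (z *: s)) zE nrm2Z.
have := sqmod_ge0 z; have := nrm2_ge0 s.
move: (sqmod z) (nrm2 s) (nrm2 x) l0 => q a b l0 a0 q0 h.
rewrite -(ler_pM2l l0); nra.
Qed.

Lemma sqmodM (z w : C) : sqmod (z * w) = sqmod z * sqmod w.
Proof. by case: z => a b; case: w => u v; rewrite /sqmod /=; ring. Qed.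

Lemma sqmodD_le (z w : C) : sqmod (z + w) <= 2 * sqmod z + 2 * sqmod w.
Proof.
case: z => a b; case: w => u v; rewrite /sqmod /=.
have := sqr_ge0 (a - u); have := sqr_ge0 (b - v); lra.
Qed.

Lemma op_norm_lt H K (T : H -> K) (e : R) : linear T -> 0 < e ->
  (op_norm T < e%:E)%E -> forall x, nrm2 (T x) <= e ^+ 2 * nrm2 x.
Proof.
move=> lT e0 /ltW hT x.
have lA (i j : 'I_1) : linear ((const_mx T : 'M[H -> K]_1) i j) by rewrite mxE.
have := (opmx_norm_leP lA (sqr_ge0 e)).1; rewrite sqrtr_sqr gtr0_norm //.
by move=> /(_ hT (const_mx x)); rewrite /sdot !big_ord1 !mxE big_ord1 !mxE.
Qed.

Section Coordinates.
Variables (H K : hilbert R) (d : nat) (Q : 'I_d -> H -> K).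
Hypothesis Q_free : op_free Q.
Hypothesis Q_bounded : forall j, bounded_op (Q j).

(** A coefficient vector killed by all samples <Q_j r, s> gives a vanishing combination of the Q_j;
    by freeness the sample matrix has trivial kernel, hence a left inverse [N]. *)
Lemma dual_family : exists p (N : 'M[C]_(d, p)) (r : 'I_p -> H) (s : 'I_p -> K),
  forall l j, \sum_k N l k * hdot K (Q j (r k)) (s k) = (l == j)%:R.
Proof.
pose D (u : 'rV[C]_d) := exists r s, u = \row_j hdot K (Q j r) s.
have [p [M [DM subM]]] := row_sample D.
have [q [I [I' [N [MI _ IN]]]]] := kernel_splitting M.
have I0 : I = 0.
  apply/matrixP => j k; rewrite [RHS]mxE.
  apply: (Q_free (c := fun j => I j k)); apply/funext => x.
  rewrite fct_sumE; apply: rdot_ext => y; rewrite rdot0l.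
  rewrite /rdot (_ : hdot K _ y = 0) //.
  have /subM/submxP[e eE] : D (\row_j hdot K (Q j x) y) by exists x, y.
  have := congr1 (fun u : 'rV[C]_q => u 0 k) (congr1 (mulmx^~ I) eE).
  rewrite /= -mulmxA MI mulmx0 !mxE => e0; rewrite -[RHS]e0.
  rewrite (big_morph (fun z => hdot K z y) (fun u v => linearDl _ _ _ _) (linear0l _ _)).
  apply: eq_bigr => i _.
  by rewrite linearZl_LR mxE mulrC.
have rs i : exists rs : H * K, row i M = \row_j hdot K (Q j rs.1) rs.2.
  by have [r [s e]] := DM i; exists (r, s).
have [rs' rsE] := choice rs.
exists p, N, (fun k => (rs' k).1), (fun k => (rs' k).2) => l j.
have /matrixP/(_ l j) := IN; rewrite I0 mul0mx add0r !mxE => <-.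
apply: eq_bigr => k _; congr (_ * _).
by have /rowP/(_ j) := rsE k; rewrite !mxE.
Qed.

(** Finite combinations of matrix coefficients make the coordinates bounded on all operators. They
    serve to close the span and to read off the coordinates of projected operators. *)
Lemma coordinates : exists ell : 'I_d -> (H -> K) -> C,
  [/\ forall l (a : C) S T, ell l (a *: S + T) = a * ell l S + ell l T,
      forall l j, ell l (Q j) = (l == j)%:R &
      forall l, exists2 c, 0 <= c & forall T b, 0 <= b ->
        (forall x, nrm2 (T x) <= b * nrm2 x) -> sqmod (ell l T) <= c * b].
Proof.
have [p [N [r [s NQ]]]] := dual_family.
exists (fun l T => \sum_k N l k * hdot K (T (r k)) (s k)); split=> //.
  move=> l a S T; rewrite mulr_sumr -big_split; apply: eq_bigr => k _ /=.
  by rewrite linearDl /= linearZl_LR mulrDr mulrCA.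
move=> l; elim: (index_enum _) => [|k ks [c c0 hc]].
  by exists 0 => // T b _ _; rewrite big_nil /sqmod /= expr0n addr0 mul0r.
pose e := sqmod (N l k) * ((nrm2 (s k) + 1) * nrm2 (r k)).
exists (2 * e + 2 * c) => [|T b b0 hT].
  rewrite addr_ge0 ?mulr_ge0 ?sqmod_ge0 ?nrm2_ge0 //.
  by rewrite addr_ge0 ?nrm2_ge0.
rewrite big_cons; apply: le_trans (sqmodD_le _ _) _; rewrite [leRHS]mulrDl lerD //.
  rewrite sqmodM -mulrA ler_wpM2l // /e -mulrA ler_wpM2l ?sqmod_ge0 //.
  apply: le_trans (sqmod_hdot_le _ _) _; rewrite -mulrA ler_wpM2l //.
    by rewrite addr_ge0 ?nrm2_ge0.
  by rewrite mulrC; have := hT (r k); rewrite mulrC.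
by rewrite -mulrA ler_wpM2l //; apply: hc.
Qed.

Lemma op_span_linear (ell : 'I_d -> (H -> K) -> C) T :
  (forall l (a : C) S T, ell l (a *: S + T) = a * ell l S + ell l T) ->
  (forall l j, ell l (Q j) = (l == j)%:R) ->
  op_span Q T -> T = \sum_l ell l T *: Q l.
Proof.
move=> ell_lin ellQ [c ->]; apply: eq_bigr => l _; congr (_ *: _).
have ell0 k : ell k 0 = 0.
  have := ell_lin k (-1) 0 0; rewrite scaler0 addr0 mulN1r => /eqP.
  by rewrite addrC subrr => /eqP.
have -> : ell l (\sum_j c j *: Q j) = \sum_j c j * ell l (Q j).
  elim/big_rec2: _ => [|j y1 y2 _ <-]; first exact: ell0.
  exact: ell_lin.
by rewrite (bigD1 l) //= ellQ eqxx mulr1 big1 ?addr0 // => j /negPf jl;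
  rewrite ellQ eq_sym jl mulr0.
Qed.

Lemma operator_space_span : operator_space (op_span Q).
Proof.
have [ell [ell_lin ellQ ell_bd]] := coordinates.
split.
- by move=> _ [c ->]; apply: bounded_op_sum.
- by exists (fun=> 0); rewrite big1 // => j _; rewrite scale0r.
- move=> a _ _ [c ->] [c' ->]; exists (fun j => a * c j + c' j).
  rewrite scaler_sumr -big_split; apply: eq_bigr => j _ /=.
  by rewrite scalerA scalerDl.
move=> T bT clT; exists (fun l => ell l T); apply/funext => x.
rewrite fct_sumE; apply: subr0_eq; apply: nrm2_eq0.
(* The left-hand side is a bounded function of T vanishing on the span. *)
pose phi (T : H -> K) := T x - (\sum_l ell l T *: Q l x).
have phiB S S' : phi (S \- S') = phi S - phi S'.
  rewrite /phi.
  have E l : ell l (S \- S') = ell l S - ell l S'.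
    have -> : S \- S' = -1 *: S' + S by rewrite scaleN1r [RHS]addrC.
    by rewrite ell_lin mulN1r addrC.
  under eq_bigr do rewrite E scalerBl.
  by rewrite sumrB /= !opprD !opprK addrACA.
have phiS S : op_span Q S -> phi S = 0.
  move=> /(op_span_linear ell_lin ellQ) SE; rewrite /phi {1}SE fct_sumE.
  exact: subrr.
have [c c0 hc] : exists2 c, 0 <= c & forall S b, 0 <= b ->
    (forall y, nrm2 (S y) <= b * nrm2 y) -> nrm2 (phi S) <= c * b.
  have [c c0 hc] : exists2 c, 0 <= c & forall S b, 0 <= b ->
      (forall y, nrm2 (S y) <= b * nrm2 y) -> nrm2 (\sum_l ell l S *: Q l x) <= c * b.
    elim: (index_enum _) => [|l ls [c c0 hc]].
      by exists 0 => // S b _ _; rewrite big_nil rdot0l mul0r.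
    have [e e0 he] := ell_bd l.
    exists (2 * (e * nrm2 (Q l x)) + 2 * c) => [|S b b0 hS].
      by rewrite addr_ge0 ?mulr_ge0 ?nrm2_ge0.
    rewrite big_cons; apply: le_trans (rdotD_le _ _) _; rewrite [leRHS]mulrDl lerD //.
      rewrite nrm2Z -mulrA ler_wpM2l // mulrAC ler_wpM2r ?nrm2_ge0 //.
      exact: he.
    by rewrite -mulrA ler_wpM2l //; apply: hc.
  exists (2 * nrm2 x + 2 * c) => [|S b b0 hS].
    by rewrite addr_ge0 ?mulr_ge0 ?nrm2_ge0.
  apply: le_trans (rdotD_le _ _) _; rewrite [leRHS]mulrDl lerD //.
    by rewrite -mulrA ler_wpM2l // mulrC; apply: hS.
  by rewrite -mulrA ler_wpM2l // rdotNl rdotNr opprK; apply: hc.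
apply/eqP; rewrite eq_le nrm2_ge0 andbT leNgt; apply/negP => pos.
rewrite -/(phi T) in pos.
(* Approximating T up to sqrt q gives |phi T|^2 <= c q, whereas |phi T|^2 = 2 (c + 1) q. *)
pose q := nrm2 (phi T) / (2 * (c + 1)).
have q0 : 0 < q by rewrite divr_gt0 // mulr_gt0 //; lra.
have e0 : 0 < Num.sqrt q by rewrite sqrtr_gt0.
have [S ES hS] := clT _ e0.
have lTS : linear (T \- S).
  have [lT _] := bT; have [lS _] : bounded_op S.
    by case: ES => s ->; apply: bounded_op_sum.
  by move=> a y z; rewrite /= lT lS scalerBr opprD addrACA.
have := hc _ _ (sqr_ge0 _) (op_norm_lt lTS e0 hS).
rewrite phiB (phiS _ ES) subr0 sqr_sqrtr ?(ltW q0) // => h.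
have : nrm2 (phi T) = q * (2 * (c + 1)) by rewrite /q divfK // gt_eqF // mulr_gt0 //; lra.
have := mulr_ge0 c0 (ltW q0); lra.
Qed.

End Coordinates.
End OperatorSpaces.

(** * Representation of functionals by operators *)

Section CoefficientFunctionals.
Variable R : realType.
Local Notation C := R[i].
Implicit Types H K : hilbert R.
Local Notation nrm2 x := (rdot x x).
Local Notation snrm2 x := (sdot x x).

(** The elementary tensor of [g] with the rank-one operator <., s> r; [tens] is a finite sum of
    these. *)
Definition tau (W : Type) H K (g : W -> C) (s : K) (r : H) : W -> K -> H :=
  fun w s' => (g w * hdot K s' s) *: r.

Definition coef d n (A : mtuple R d n) (i k : 'I_n) : seq 'I_d -> C :=
  fun w => wmx A w i k.

Lemma tensE d H K n (A : mtuple R d n) (al : 'cV[K]_n) (be : 'cV[H]_n) :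
  tens A al be = \sum_i \sum_k tau (coef A i k) (al i 0) (be k 0).
Proof.
apply/funext => w; apply/funext => s; rewrite fct_sumE fct_sumE.
under eq_bigr do rewrite !fct_sumE.
rewrite /tens mxE exchange_big; apply: eq_bigr => k _.
rewrite mxE scaler_suml; apply: eq_bigr => i _.
by rewrite mxE mulrC.
Qed.

Lemma wmx_dsum d n m (A : mtuple R d n) (B : mtuple R d m) w :
  wmx (mt_dsum A B) w = block_mx (wmx A w) 0 0 (wmx B w).
Proof.
elim: w => [|j w IH] /=; first by rewrite scalar_mx_block.
by rewrite IH ffunE mulmx_block !(mulmx0, mul0mx, addr0, add0r).
Qed.

Lemma wmx_conj d n (A : mtuple R d n) (S : 'M[C]_n) w : S \in unitmx ->
  wmx (mt_conj S A) w = invmx S *m wmx A w *m S.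
Proof.
move=> Su; elim: w => [|j w IH] /=; first by rewrite mulmx1 mulVmx.
by rewrite IH ffunE !mulmxA mulmxK // -!mulmxA.
Qed.

Lemma prow_col H n m (al : 'cV[H]_n) (al' : 'cV[H]_m) s :
  prow (col_mx al al') s = row_mx (prow al s) (prow al' s).
Proof.
apply/rowP => i; case: (split_ordP i) => j ->.
  by rewrite row_mxEl mxE col_mxEu mxE.
by rewrite row_mxEr mxE col_mxEd mxE.
Qed.

Lemma tens_dsum d H K n m (A : mtuple R d n) (B : mtuple R d m)
    (al : 'cV[K]_n) (be : 'cV[H]_n) (al' : 'cV[K]_m) (be' : 'cV[H]_m) :
  tens (mt_dsum A B) (col_mx al al') (col_mx be be') =
  tens A al be + tens B al' be'.
Proof.
apply/funext => w; apply/funext => s.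
have -> : (tens A al be + tens B al' be') w s = tens A al be w s + tens B al' be' w s by [].
rewrite /tens prow_col wmx_dsum mul_row_block !mulmx0 addr0 add0r smul_row_col.
by rewrite mxE.
Qed.

Lemma tens_scaler d H K n (A : mtuple R d n) (al : 'cV[K]_n) (be : 'cV[H]_n) a :
  tens A al (smul a%:M be) = a *: tens A al be.
Proof.
apply/funext => w; apply/funext => s.
have -> : (a *: tens A al be) w s = a *: tens A al be w s by [].
rewrite /tens -smulA mul_mx_scalar -mul_scalar_mx [smul (a%:M *m _) _]smulA.
by rewrite smul_scalarE.
Qed.

Lemma tens_scalel d H K n (A : mtuple R d n) (al : 'cV[K]_n) (be : 'cV[H]_n) (a : R) :
  tens A (smul (a%:C%C)%:M al) be = a%:C%C *: tens A al be.
Proof.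
rewrite -tens_scaler; apply/funext => w; apply/funext => s.
rewrite /tens prow_smul tr_scalar_mx map_scalar_mx /= conj_real -smulA.
by rewrite mul_mx_scalar -scalemxAl mul_mx_scalar.
Qed.

Lemma sdot_single H n (x : H) i (v : 'cV[H]_n) :
  sdot v (\col_k (if k == i then x else 0)) = rdot (v i 0) x.
Proof.
rewrite /sdot (bigD1 i) //= mxE eqxx big1 ?addr0 // => k /negPf ki.
by rewrite mxE ki rdot0r.
Qed.

Lemma tens_single d H K n (A : mtuple R d n) i k (s : K) (r : H) :
  tens A (\col_l (if l == i then s else 0)) (\col_l (if l == k then r else 0)) =
  tau (coef A i k) s r.
Proof.
have tau0l (g : seq 'I_d -> C) (x : H) : tau g (0 : K) x = 0.
  by apply/funext => w; apply/funext => s'; rewrite /tau linear0r mulr0 scale0r.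
have tau0r (g : seq 'I_d -> C) (x : K) : tau g x (0 : H) = 0.
  by apply/funext => w; apply/funext => s'; rewrite /tau scaler0.
rewrite tensE (bigD1 i) //= [X in _ + X]big1 ?addr0 => [|j /negPf ji]; last first.
  by apply: big1 => l _; rewrite mxE ji tau0l.
rewrite (bigD1 k) //= !mxE !eqxx big1 ?addr0 // => l /negPf lk.
by rewrite mxE lk tau0r.
Qed.

(** A complex scalar on [g] passes to [s]; this is how a real-linear functional yields operators
    depending complex-linearly on [g]. *)
Lemma tau_linl (W : Type) H K a (g h : W -> C) (s : K) (r : H) :
  tau (a *: g + h) s r = tau g (a^* *: s) r + tau h s r.
Proof.
apply/funext => w; apply/funext => s'.
have -> : (tau g (a^* *: s) r + tau h s r) w s' =
  tau g (a^* *: s) r w s' + tau h s r w s' by [].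
rewrite /tau (_ : (a *: g + h) w = a * g w + h w) //.
rewrite hdotZr conjCK mulrDl scalerDl; congr (_ *: _ + _).
by rewrite mulrCA mulrA.
Qed.

Lemma tau_linm (W : Type) H K (a : R) (g : W -> C) (s s' : K) (r : H) :
  tau g (a%:C%C *: s + s') r = a%:C%C *: tau g s r + tau g s' r.
Proof.
apply/funext => w; apply/funext => t.
have -> : (a%:C%C *: tau g s r + tau g s' r) w t =
  a%:C%C *: tau g s r w t + tau g s' r w t by [].
by rewrite /tau linearDr /= hdotZr conj_real scalerA -scalerDl mulrDr mulrCA.
Qed.

Lemma tau_linr (W : Type) H K a (g : W -> C) (s : K) (r r' : H) :
  tau g s (a *: r + r') = tau g (a^* *: s) r + tau g s r'.
Proof.
apply/funext => w; apply/funext => s'.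
have -> : (tau g (a^* *: s) r + tau g s r') w s' =
  tau g (a^* *: s) r w s' + tau g s r' w s' by [].
rewrite /tau scalerDr scalerA; congr (_ *: _ + _).
by rewrite hdotZr conjCK mulrCA mulrC.
Qed.

Section Representation.
Variables (H K : hilbert R) (d : nat) (f : (seq 'I_d -> K -> H) -> R).
Hypothesis f_lin : forall (a : R) u v, f (a%:C%C *: u + v) = a * f u + f v.

Lemma functional0 : f 0 = 0.
Proof. by have := f_lin (-1) 0 0; rewrite scaler0 addr0 mulN1r addrC; lra. Qed.

Lemma functionalD u v : f (u + v) = f u + f v.
Proof. by have := f_lin 1 u v; rewrite rmorph1 scale1r mul1r. Qed.

Lemma functional_sum I (r : seq I) (P : pred I) (F : I -> seq 'I_d -> K -> H) :
  f (\sum_(i <- r | P i) F i) = \sum_(i <- r | P i) f (F i).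
Proof. apply: (big_morph f functionalD functional0). Qed.

Definition represents (g : seq 'I_d -> C) (T : H -> K) :=
  bounded_op T /\ forall r s, rdot (T r) s = f (tau g s r).

Lemma represents_inj g S T : represents g S -> represents g T -> S = T.
Proof.
move=> [_ hS] [_ hT]; apply/funext => r; apply: rdot_ext => s.
by rewrite hS hT.
Qed.

Lemma represents_lin a g h S T :
  represents g S -> represents h T -> represents (a *: g + h) (a *: S + T).
Proof.
move=> [bS hS] [bT hT]; split=> [|r s]; first exact: bounded_op_lin.
rewrite tau_linl functionalD -hS -hT (_ : (a *: S + T) r = a *: S r + T r) //.
by rewrite rdotDl rdotZl.
Qed.

Lemma represents0 : represents 0 0.
Proof.
split=> [|r s]; first exact: bounded_op0.
rewrite rdot0l (_ : tau 0 s r = 0) ?functional0 //.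
by apply/funext => w; apply/funext => s'; rewrite /tau mul0r scale0r.
Qed.

Lemma represents_exists g :
  (forall s r, f (tau g s r) <= (nrm2 s + nrm2 r) / 2) -> exists T, represents g T.
Proof.
move=> hg.
have Tr r : exists t, forall s, f (tau g s r) = rdot s t.
  apply: (@riesz _ _ _ (nrm2 r / 2)) => [a x y|x]; first by rewrite tau_linm f_lin.
  by have := hg x r; lra.
have [T hT] := choice Tr; exists T; split=> [|r s]; last by rewrite hT rdotC.
apply/bounded_opP; split=> [a x y|].
  apply: rdot_ext => s; rewrite rdotC -hT tau_linr functionalD !hT rdotDl.
  by rewrite [rdot (a *: _) _]rdotZl [RHS]addrC [in RHS](rdotC (T y)) [in RHS](rdotC (T x)) addrC.
(* Taking s = T r gives |T r|^2 <= (|T r|^2 + |r|^2) / 2. *)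
exists 1 => // r; have := hg (T r) r; rewrite hT; lra.
Qed.

End Representation.
End CoefficientFunctionals.

(** * The extension theorem *)

Section ExtensionTheorem.
Variable R : realType.
Local Notation C := R[i].
Local Notation nrm2 x := (rdot x x).
Local Notation snrm2 x := (sdot x x).
Variables (R1 S1 R2 S2 : hilbert R) (d1 d2 : nat).
Variables (Q1 : 'I_d1 -> R1 -> S1) (Q2 : 'I_d2 -> R2 -> S2).
Hypothesis Q1_bounded : forall j, bounded_op (Q1 j).
Hypothesis Q2_bounded : forall j, bounded_op (Q2 j).
Hypothesis Q2_free : op_free Q2.
Let linQ1 j : linear (Q1 j). Proof. by case: (Q1_bounded j). Qed.
Let linQ2 j : linear (Q2 j). Proof. by case: (Q2_bounded j). Qed.

Section Extend.
Variables (X : nc_subset R d1) (F0 : forall n, mtuple R d1 n -> mtuple R d2 n).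
Hypothesis X_nc : nc_set X.
Hypothesis X_sub : forall n, @X n `<=` nc_ball Q1 n.
Hypothesis X_full : relatively_full X (nc_ball Q1).
Hypothesis X_neq0 : exists n (A : mtuple R d1 n), X A.
Hypothesis F0_nc : nc_map X (nc_cball Q2) F0.

Lemma functional_extension : exists f : (seq 'I_d1 -> S2 -> R2) -> R,
  [/\ forall (a : R) u v, f (a%:C%C *: u + v) = a * f u + f v,
      forall n (Z : mtuple R d1 n) al be, X Z ->
        f (tens Z al be) = sdot (qact Q2 (F0 Z) be) al &
      forall n (A : mtuple R d1 n) al be, nc_ball Q1 n A ->
        f (tens A al be) <= (snrm2 al + snrm2 be) / 2].
Proof.
pose D : set ((seq 'I_d1 -> S2 -> R2) * R) := [set z |
  exists n (A : mtuple R d1 n) al be,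
    nc_ball Q1 n A /\ z = (tens A al be, (snrm2 al + snrm2 be) / 2)].
pose S0 : set ((seq 'I_d1 -> S2 -> R2) * R) := [set z |
  exists n (Z : mtuple R d1 n) al be,
    X Z /\ z = (tens Z al be, sdot (qact Q2 (F0 Z) be) al)].
have [n0 [Z0 XZ0]] := X_neq0.
have qactZ n (Z : mtuple R d1 n) (a : R) be :
    qact Q2 (F0 Z) (smul (a%:C%C)%:M be) = smul (a%:C%C)%:M (qact Q2 (F0 Z) be).
  rewrite -qact_mulr // -qact_mull; apply: eq_qact => j.
  by rewrite mul_mx_scalar mul_scalar_mx.
have [|||||||f [f_lin fS fD]] := @hahn_banach _ _ D S0.
- move=> _ _ _ _ [n [A [al [be [bA [-> ->]]]]]] [m [B [al' [be' [bB [-> ->]]]]]].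
  exists (n + m)%N, (mt_dsum A B), (col_mx al al'), (col_mx be be').
  split; first exact: nc_ball_dsum.
  by rewrite tens_dsum !sdot_col; congr (_, _); lra.
- move=> a _ _ a0 [n [A [al [be [bA [-> ->]]]]]].
  exists n, A, (smul ((Num.sqrt a)%:C%C)%:M al), (smul ((Num.sqrt a)%:C%C)%:M be).
  split=> //; rewrite tens_scaler tens_scalel scalerA -rmorphM -expr2 !snrm2R.
  by rewrite sqr_sqrtr ?(ltW a0) //; congr (_, _); lra.
(* The negative of a moment is the moment with - be, which has the same size. *)
- move=> _ _ [n [A [al [be [bA [-> _]]]]]].
  exists ((snrm2 al + snrm2 (smul ((-1)%:C%C)%:M be)) / 2), n, A, al, (smul ((-1)%:C%C)%:M be).
  by split=> //; rewrite tens_scaler rmorphN1 scaleN1r.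
- exists n0, Z0, 0, (smul (0%:C%C)%:M 0); split; first exact: X_sub.
  by rewrite tens_scaler scale0r snrm2R sdot0l expr0n mul0r addr0 mul0r.
- move=> a _ _ _ _ [n [A [al [be [XA [-> ->]]]]]] [m [B [al' [be' [XB [-> ->]]]]]].
  exists (n + m)%N, (mt_dsum A B), (col_mx al al'), (col_mx (smul (a%:C%C)%:M be) be').
  split; first exact: X_nc.
  rewrite tens_dsum tens_scaler; congr (_, _).
  have [_ -> // _] := F0_nc.
  rewrite (@eq_qact _ _ _ _ _ _ _ _ (fun j => block_mx (F0 A j) 0 0 (F0 B j))) => [|j]; last by rewrite ffunE.
  by rewrite qact_block !qact0l add0r addr0 sdot_col qactZ sdotR.
- by exists (tens Z0 0 0, sdot (qact Q2 (F0 Z0) 0) 0), n0, Z0, 0, 0.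
- move=> _ _ _ [n [Z [al [be [XZ [-> ->]]]]]] [m [A [al' [be' [bA [e ->]]]]]].
  have := coefficient_functional_bound Q1_bounded Q2_bounded X_nc X_sub X_full F0_nc XZ bA e.
  lra.
exists f; split=> // [n Z al be XZ|n A al be bA].
  by apply: fS; exists n, Z, al, be.
by apply: fD; exists n, A, al, be.
Qed.

Hypothesis Q2_injective : injective_operator_space (op_span Q2).

Lemma nc_map_extension : exists F : forall n, mtuple R d1 n -> mtuple R d2 n,
  nc_map (nc_ball Q1) (nc_cball Q2) F /\
  forall n (A : mtuple R d1 n), X A -> F n A = F0 A.
Proof.
have [f [f_lin fX fB]] := functional_extension.
have [ell [ell_lin ellQ _]] := coordinates Q2_free.
(* Injectivity applied to the identity of the span, inside all bounded operators, yields the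
   projection. *)
have [v [[v_span v_lin v_cc] v_id]] : exists v,
    completely_contractive (@bounded_op R R2 S2) (op_span Q2) v /\
    forall T, op_span Q2 T -> v T = T.
  apply: (Q2_injective (operator_space_span Q2_free Q2_bounded)
    (operator_space_bounded R2 S2) _ (u := id)).
    by have [] := operator_space_span Q2_free Q2_bounded.
  by split=> // n A _; rewrite map_mx_id.
(* The default 0 is harmless: [coef_rep] shows that every entry function of a point of the ball is
   represented. *)
pose U g := match pselect (exists T, represents f g T) with
  | left h => projT1 (cid h) | right _ => 0 end.
have UP g T : represents f g T -> U g = T.
  move=> gT; rewrite /U; case: pselect => [h|[]]; last by exists T.
  by case: (cid h) => S /= gS; apply: represents_inj gS gT.
have coef_rep n (A : mtuple R d1 n) i k : nc_ball Q1 n A ->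
    represents f (coef A i k) (U (coef A i k)).
  move=> bA.
  have [T hT] : exists T, represents f (coef A i k) T.
    apply: represents_exists => // s r; rewrite -tens_single.
    apply: le_trans (fB _ _ _ _ bA) _; rewrite !sdot_single !mxE !eqxx.
    exact: lexx.
  by rewrite (UP _ _ hT).
pose kap l g := ell l (v (U g)).
have v0 : v 0 = 0.
  have := v_lin (-1) 0 0 (bounded_op0 R2 S2) (bounded_op0 R2 S2).
  by rewrite scaler0 addr0 scaleN1r addNr.
have ell0 l : ell l 0 = 0.
  have := ell_lin l (-1) 0 0; rewrite scaler0 addr0 mulN1r => /eqP.
  by rewrite addrC subrr => /eqP.
have kap0 l : kap l 0 = 0 by rewrite /kap (UP _ _ (represents0 f_lin)) v0 ell0.
have kap_sum l I (r : seq I) (a : I -> C) (g : I -> seq 'I_d1 -> C) :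
    (forall i, represents f (g i) (U (g i))) ->
    kap l (\sum_(i <- r) a i *: g i) = \sum_(i <- r) a i * kap l (g i).
  move=> gr.
  suff [T [hT ->]] : exists T, represents f (\sum_(i <- r) a i *: g i) T /\
      \sum_(i <- r) a i * kap l (g i) = ell l (v T).
    by rewrite /kap (UP _ _ hT).
  elim: r => [|i r [T [hT IH]]].
    exists 0; rewrite !big_nil v0 ell0; split=> //; exact: represents0.
  exists (a i *: U (g i) + T); rewrite !big_cons; split.
    exact: represents_lin.
  rewrite v_lin; [|by case: (gr i)|by case: hT].
  by rewrite ell_lin IH.
pose F n (A : mtuple R d1 n) : mtuple R d2 n :=
  [ffun l => \matrix_(i, k) kap l (coef A i k)].
have FE n (A : mtuple R d1 n) l i k : F n A l i k = kap l (coef A i k).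
  by rewrite ffunE mxE.
exists F; split; last first.
  move=> n A XA; apply/ffunP => l; apply/matrixP => i k; rewrite FE /kap.
  have span : op_span Q2 (nc_lin Q2 (F0 A) i k) by exists (fun j => F0 A j i k); rewrite mxE.
  rewrite (UP _ (nc_lin Q2 (F0 A) i k)); last first.
    have [sb _ _ _] := operator_space_span Q2_free Q2_bounded.
    split=> [|r s]; first exact: sb.
    rewrite -tens_single fX // sdot_single -opmx_apply_nc_lin [in RHS]mxE.
    have colE j : (\col_l (if l == k then r else 0)) j 0 = if j == k then r else 0.
      by rewrite mxE.
    rewrite (bigD1 k) //= colE eqxx big1 ?addr0 // => j /negPf jk.
    by rewrite colE jk linear_map0 //; apply: linear_nc_lin.
  rewrite v_id // mxE.
  have ell_sum (c : 'I_d2 -> C) : ell l (\sum_j c j *: Q2 j) = \sum_j c j * ell l (Q2 j).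
    elim/big_rec2: _ => [|j y1 y2 _ <-]; first exact: ell0.
    exact: ell_lin.
  rewrite ell_sum (bigD1 l) //= ellQ eqxx mulr1 big1 ?addr0 // => j /negPf jl.
  by rewrite ellQ eq_sym jl mulr0.
split.
- move=> n A bA; split; first by case: bA.
  pose UA : 'M[R2 -> S2]_n := \matrix_(i, k) U (coef A i k).
  have bUA i k : bounded_op (UA i k) by rewrite mxE; case: (coef_rep _ _ i k bA).
  have lUA i k : linear (UA i k) by case: (bUA i k).
  have -> : nc_lin Q2 (F n A) = map_mx v UA.
    apply/matrixP => i k; rewrite mxE [RHS]mxE mxE.
    rewrite [RHS](op_span_linear ell_lin ellQ); last first.
      by apply: v_span; case: (coef_rep _ _ i k bA).
    by apply: eq_bigr => l _; rewrite FE.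
  apply: le_trans (v_cc _ _ bUA) _.
  rewrite -sqrtr1; apply/opmx_norm_leP => // be; rewrite mul1r.
  (* Testing [f] with al = UA be turns the half sum of squares into |UA be| <= |be|. *)
  have e : snrm2 (opmx_apply UA be) = f (tens A (opmx_apply UA be) be).
    rewrite tensE functional_sum // {1}/sdot; apply: eq_bigr => i _.
    rewrite functional_sum // {1}mxE rdot_suml; apply: eq_bigr => k _.
    by rewrite [UA i k]mxE; case: (coef_rep _ _ i k bA) => _ ->.
  have := fB _ _ (opmx_apply UA be) be bA; rewrite -e; lra.
- move=> n m A B bA bB; apply/ffunP => l; apply/matrixP => i k.
  rewrite FE [in RHS]ffunE.
  have cE a b : coef (mt_dsum A B) a b = fun w => block_mx (wmx A w) 0 0 (wmx B w) a b.
    by apply/funext => w; rewrite /coef wmx_dsum.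
  rewrite cE; case: (split_ordP i) => i' ->; case: (split_ordP k) => k' ->.
  + rewrite block_mxEul FE; congr (kap l _); apply/funext => w.
    by rewrite block_mxEul.
  + rewrite block_mxEur [RHS]mxE -[RHS](kap0 l); congr (kap l _); apply/funext => w.
    by rewrite block_mxEur mxE.
  + rewrite block_mxEdl [RHS]mxE -[RHS](kap0 l); congr (kap l _); apply/funext => w.
    by rewrite block_mxEdl mxE.
  + rewrite block_mxEdr FE; congr (kap l _); apply/funext => w.
    by rewrite block_mxEdr.
move=> n A S Su bA bSA; apply/ffunP => l; apply/matrixP => i k.
rewrite FE [in RHS]ffunE.
have -> : coef (mt_conj S A) i k =
    \sum_(p : 'I_n * 'I_n) (invmx S i p.1 * S p.2 k) *: coef A p.1 p.2.
  apply/funext => w; rewrite fct_sumE /coef wmx_conj //.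
  rewrite -(pair_bigA_idem _ (fun a b => (invmx S i a * S b k) *: wmx A w a b)) /=; last by rewrite addr0.
  rewrite mxE exchange_big; apply: eq_bigr => b _; rewrite mxE mulr_suml.
  by apply: eq_bigr => a _; rewrite mulrAC.
rewrite kap_sum => [|p]; last exact: coef_rep.
rewrite -(pair_bigA_idem _ (fun a b => (invmx S i a * S b k) * kap l (coef A a b))) /=; last by rewrite addr0.
rewrite mxE exchange_big; apply: eq_bigr => b _; rewrite mxE mulr_suml.
by apply: eq_bigr => a _; rewrite FE mulrAC.
Qed.

End Extend.
End ExtensionTheorem.

Theorem theorem6p5 (R : realType) (d1 d2 : nat) (R1 S1 R2 S2 : hilbert R)
    (Q1 : 'I_d1 -> R1 -> S1) (Q2 : 'I_d2 -> R2 -> S2)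
    (Q1_bounded : forall j, bounded_op (Q1 j)) (Q1_free : op_free Q1)
    (Q2_bounded : forall j, bounded_op (Q2 j)) (Q2_free : op_free Q2)
    (X : nc_subset R d1)
    (X_nc : nc_set X) (X_sub : forall n, X n `<=` nc_ball Q1 n)
    (X_full : relatively_full X (nc_ball Q1))
    (Q2_injective : injective_operator_space (op_span Q2))
    (F0 : forall n, mtuple R d1 n -> mtuple R d2 n)
    (F0_nc : nc_map X (nc_cball Q2) F0) :
  exists F : forall n, mtuple R d1 n -> mtuple R d2 n,
    [/\ nc_map (nc_ball Q1) (nc_cball Q2) F,
        (forall n (A : mtuple R d1 n), X n A -> F n A = F0 n A),
        ((forall n (A : mtuple R d1 n), X n A -> nc_ball Q2 n (F0 n A)) ->
          forall n (A : mtuple R d1 n), nc_ball Q1 n A -> nc_ball Q2 n (F n A)) &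
        ((exists n, exists A : mtuple R d1 n, X n A /\ nc_sphere Q2 n (F0 n A)) ->
          forall n (A : mtuple R d1 n), nc_ball Q1 n A -> nc_sphere Q2 n (F n A))].
Proof.
have linQ1 j : linear (Q1 j) by case: (Q1_bounded j).
have linQ2 j : linear (Q2 j) by case: (Q2_bounded j).
have [[n0 [Z0 XZ0]]|Xe] := pselect (exists n (A : mtuple R d1 n), X n A).
  have [F [Fnc FX]] := nc_map_extension Q1_bounded Q2_bounded Q2_free X_nc X_sub X_full
    (ex_intro _ n0 (ex_intro _ Z0 XZ0)) F0_nc Q2_injective.
  exists F; split=> //.
    move=> F0b n A bA; apply: (nc_map_strict Q1_bounded Q2_bounded Fnc (X_sub _ _ XZ0) bA).
    by rewrite FX //; apply: F0b.
  move=> [m [Z [XZ [cZ nbZ]]]] n A bA; split; first by case: Fnc => + _ _; apply.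
  (* A strict value at [A] would force a strict value at [Z]. *)
  move=> bFA; apply: nbZ; rewrite -FX //.
  exact: (nc_map_strict Q1_bounded Q2_bounded Fnc bA (X_sub _ _ XZ) bFA).
(* For empty X the zero map is taken: its values are strict, and the hypothesis of the boundary case
   fails. *)
have ball0 n : (0 < n)%N -> nc_ball Q2 n [ffun=> 0].
  move=> n0; apply/nc_ballP => //; split=> //; exists 0; first by rewrite lexx ltr01.
  move=> v; rewrite (@eq_qact _ _ _ _ _ _ _ _ (fun=> 0)) => [|j]; last by rewrite ffunE.
  by rewrite qact0l sdot0l mul0r.
exists (fun n _ => [ffun=> 0]); split.
- split=> [n A [n0 _]|n m A B _ _|n A S _ _ _].
  + by have [? /ltW] := ball0 n n0.
  + by apply/ffunP => j; rewrite !ffunE block_mx0.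
  + by apply/ffunP => j; rewrite !ffunE mulmx0 mul0mx.
- by move=> n A XA; exfalso; apply: Xe; exists n, A.
- by move=> _ n A [n0 _]; apply: ball0.
- by move=> [n [A [XA _]]]; exfalso; apply: Xe; exists n, A.
Qed.
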